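(* There is an absolute constant $c$ such that for every partial Boolean function $f$ and every integer $k\ge c\log \mathrm{Q}(f)$, \[ \mathrm{QS}(\textsc{Ind}_k\circ_k f)=\Theta(\mathrm{Q}(\textsc{Ind}_k\circ_k f))=\Theta(k\,\mathrm{Q}(f)) \] and \[ \mathrm{QS}(\textsc{UInd}_k\circ_k f)=\Theta(\mathrm{Q}(\textsc{UInd}_k\circ_k f))=\Theta(k\,\mathrm{Q}(f)). \]
   Context: Query model: for $x\in\{0,1\}^N$ the oracle $O_x$ acts by $O_x|i,b\rangle=|i,b\oplus x_i\rangle$. A $T$-query quantum algorithm applies input-independent unitaries $U_0,\dots,U_T$ interleaved with $O_x$ to $|0^m\rangle$. It then measures to output a bit, or outputs the state obtained by tracing out a fixed subset of qubits. The trace distance is $\|\rho-\sigma\|_{tr}=\tfrac12\|\rho-\sigma\|_1$. $\mathrm{Q}(g)$ is the minimum $T$ such that some $T$-query algorithm outputs $g(x)$ with probability at least $2/3$ on every $x\in\mathrm{Dom}(g)$. $\mathrm{QS}(g)$ is the smallest $k$ such that some $k$-query algorithm outputs states $\rho_x$ with $\|\rho_x-\rho_y\|_{tr}\ge1/6$ whenever $x,y\in\mathrm{Dom}(g)$ and $g(x)\ne g(y)$. Let $f$ be a partial function on $n$ bits. - $\textsc{Ind}_k\circ_k f$ is the function on $nk+2^k$ bits whose input is $k$ strings $z^1,\dots,z^k\in\mathrm{Dom}(f)$ followed by an array $y\in\{0,1\}^{2^k}$. Its value is $y_a$, where $a\in\{0,1\}^k$ is the string $(f(z^1),\dots,f(z^k))$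 viewed as an index into $y$. - $\textsc{UInd}_k\circ_k f$ is the partial function on $nk+2\cdot2^k$ bits whose input is $z^1,\dots,z^k\in\mathrm{Dom}(f)$ followed by an array of $2^k$ pairs of bits $(y_{2j},y_{2j+1})$, $j\in\{0,1\}^k$. Let $a=(f(z^1),\dots,f(z^k))$. The function is defined only on inputs where $y_{2a+1}=1$ and $y_{2j+1}=0$ for every $j\ne a$, and its value is $y_{2a}$. The constants in $\Theta$ are absolute.
   Formalization: The formal statement assumes Q(f) ≥ 1 and k ≥ 1: for constant f (Q(f)=0, log Q(f) undefined), or for k = 0 with Q(f) = 1, the composed functions need one query although k·Q(f) = 0, so the claimed Θ fails there. *)

(* Defs.v *)
(* complex numbers R[i] over an abstract real type R. *)
From HB Require Import structures.
From mathcomp Require Import all_boot all_order all_algebra.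
From mathcomp Require Import complex.
From mathcomp Require Import reals.
Set Implicit Arguments. Unset Strict Implicit. Unset Printing Implicit Defensive.
Import Order.TTheory GRing.Theory Num.Theory.
Local Open Scope ring_scope.

(* Bit strings and partial Boolean functions                           *)

(* x in {0,1}^N *)
Definition bits (N : nat) := {ffun 'I_N -> bool}.

(* A partial Boolean function on N bits: None = outside Dom(g). *)
Definition pfun (N : nat) := bits N -> option bool.

(* the m-th bit of x (false when m >= N; only used for m < N) *)
Definition nbit (N : nat) (x : bits N) (m : nat) : bool :=
  if insub m is Some i then x i else false.

(* the j-th block z^{j+1} of n bits of x (bits j*n .. j*n+n-1) *)
Definition block (n N : nat) (x : bits N) (j : nat) : bits n :=
  [ffun i : 'I_n => nbit x (j * n + i)].

(* If z^1,...,z^k are all in Dom f, Some a where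
   a = (f z^1, ..., f z^k) read as a binary number, f z^1 least significant. *)
Definition inner_index (n k N : nat) (f : pfun n) (x : bits N) : option nat :=
  if [forall j : 'I_k, f (block n x j) != None]
  then Some (\sum_(j < k) (odflt false (f (block n x j)) : nat) * 2 ^ j)%N
  else None.

(* Ind_k o_k f on n*k + 2^k bits *)
Definition IndComp (n k : nat) (f : pfun n) : pfun (n * k + 2 ^ k) :=
  fun x => omap (fun a => nbit x (n * k + a)) (inner_index k f x).

(* UInd_k o_k f on n*k + 2*2^k bits; pair j is (y_{2j}, y_{2j+1}) *)
Definition UIndComp (n k : nat) (f : pfun n) : pfun (n * k + 2 * 2 ^ k) :=
  fun x =>
    match inner_index k f x with
    | Some a =>
        if [forall j : 'I_(2 ^ k), nbit x (n * k + 2 * j + 1) == (j == a :> nat)]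
        then Some (nbit x (n * k + 2 * a))
        else None
    | None => None
    end.

(* Linear algebra on finite-dimensional spaces C^S, C = R[i]           *)

Definition vec (R : realType) (S : finType) := S -> R[i].
Definition op (R : realType) (S : finType) := S -> S -> R[i].

Definition basis_vec (R : realType) (S : finType) (s0 : S) : vec R S :=
  fun s => (s == s0)%:R.

Definition mapply (R : realType) (S : finType) (A : op R S) (v : vec R S)
  : vec R S := fun s => \sum_t A s t * v t.

(* U^* U = I *)
Definition unitary (R : realType) (S : finType) (U : op R S) : Prop :=
  forall s t, \sum_r (U r s)^* * U r t = (s == t)%:R.

(* ||A||_1 = v : v is the sum of the singular values of A, i.e.
   A = U diag(s) V^*, U, V unitary, s >= 0, v = sum s. *)
Definition trace_norm_is (R : realType) (K : finType) (A : op R K) (v : R[i])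
  : Prop :=
  exists (U V : op R K) (s : K -> R[i]),
    [/\ unitary U, unitary V, (forall j, 0 <= s j),
        (forall a a', A a a' = \sum_j U a j * s j * (V a' j)^*)
      & v = \sum_j s j].

(* || rho - sigma ||_tr >= t, with ||.||_tr = 1/2 ||.||_1 *)
Definition trace_dist_ge (R : realType) (K : finType) (rho sigma : op R K)
  (t : R[i]) : Prop :=
  exists v, trace_norm_is (fun a a' => rho a a' - sigma a a') v /\ t <= v / 2.

(* Query algorithms                                                    *)

(* State space: query register |i> (i < N), answer bit |b>, workspace W. *)
Definition Sp (N : nat) (W : finType) := (('I_N * bool) * W)%type.

(* O_x |i, b, w> = |i, b xor x_i, w> *)
Definition oracle (R : realType) (N : nat) (W : finType) (x : bits N)
  : op R (Sp N W) :=
  fun s' s => ((s'.1.1 == s.1.1) && (s'.1.2 == s.1.2 (+) x s.1.1)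
               && (s'.2 == s.2))%:R.

(* U_t O_x U_{t-1} ... O_x U_0 |init> *)
Fixpoint run (R : realType) (N : nat) (W : finType) (U : nat -> op R (Sp N W))
  (init : Sp N W) (x : bits N) (t : nat) : vec R (Sp N W) :=
  match t with
  | 0 => mapply (U 0%N) (basis_vec R init)
  | t'.+1 => mapply (U t) (mapply (@oracle R N W x) (run U init x t'))
  end.

(* Some T-query algorithm outputs g(x) w.p. >= 2/3 on every x in Dom(g).
   The final measurement is a computational-basis measurement followed by
   a fixed classical post-processing out. *)
Definition computes (R : realType) (N : nat) (g : pfun N) (T : nat) : Prop :=
  exists (W : finType) (U : nat -> op R (Sp N W)) (init : Sp N W)
         (out : Sp N W -> bool),
    (forall t, (t <= T)%N -> unitary (U t)) /\
    (forall x b, g x = Some b ->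
       2 / 3 <= \sum_(s | out s == b) `|run U init x T s| ^+ 2).

(* reduced state on K after tracing out the query register, answer bit
   and the register D *)
Definition reduced (R : realType) (N : nat) (K D : finType)
  (psi : vec R (Sp N (K * D)%type)) : op R K :=
  fun a a' => \sum_(q : 'I_N * bool) \sum_(d : D)
                psi (q, (a, d)) * (psi (q, (a', d)))^*.

(* Some k-query algorithm outputs states rho_x with
   ||rho_x - rho_y||_tr >= 1/6 whenever g(x) <> g(y). *)
Definition separates (R : realType) (N : nat) (g : pfun N) (T : nat) : Prop :=
  exists (K D : finType) (U : nat -> op R (Sp N (K * D)%type)) (init : Sp N (K * D)%type),
    (forall t, (t <= T)%N -> unitary (U t)) /\
    (forall x y bx byy, g x = Some bx -> g y = Some byy -> bx != byy ->
       trace_dist_ge (reduced (run U init x T)) (reduced (run U init y T))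
                     (1 / 6)).

Definition is_min (P : nat -> Prop) (q : nat) : Prop :=
  P q /\ forall t, P t -> (q <= t)%N.

(* Q(g) = q and QS(g) = q *)
Definition Q_is (R : realType) (N : nat) (g : pfun N) (q : nat) : Prop :=
  is_min (computes R g) q.
Definition QS_is (R : realType) (N : nat) (g : pfun N) (q : nat) : Prop :=
  is_min (separates R g) q.

(* Main.v *)
(* Both quantities are compared with the adversary bound of f. By semidefinite
   duality, either f has vectors a_{x,i} of cost at most d with
   sum_{i : x_i <> y_i} <a_{x,i}, a_{y,i}> = 1 whenever f(x) = 1 and f(y) = 0, or
   f has a spectral adversary matrix of norm lam > d. Such vectors yield a
   3d-query algorithm (a span program evaluated by averaging the iterates of a
   product of two reflections), and they compose: a solution of cost d for f
   gives one of cost k d + 1 for Ind_k o f and UInd_k o f, hence the O(k Q(f))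
   upper bound without a logarithmic loss. Conversely, for an adversary matrix Gam
   put G = I + 4 (I - Gam / lam). A query multiplies <G^{tensor k}> by at most
   1 + 8 / lam, and the projector onto the inputs with f = b is at most 5/9 G, so
   after T queries all k values are known with probability at most
   (5/9)^k (1 + 8 / lam)^T. An algorithm separating the two values of y_a must
   put query weight Omega(1/T) on y_a even when the array is zero, so it knows
   a = (f(z^1), ..., f(z^k)) with probability Omega(1/T^2); as T < 2^{Omega(k)},
   this forces T = Omega(k lam). *)
From mathcomp Require Import all_boot all_order all_algebra.
From mathcomp Require Import complex ring lra zify.
From mathcomp Require Import all_classical reals topology normedtype derive.
From mathcomp Require Import sequences exp.
Require Import Defs.
Set Implicit Arguments. Unset Strict Implicit. Unset Printing Implicit Defensive.
Import Order.TTheory GRing.Theory Num.Theory.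
Import numFieldNormedType.Exports.
Local Open Scope ring_scope.


(** * Inner products and operators *)

(** A separating algorithm need not output the inner values, and the all-zero array is not even a
    legal input of UInd. The hybrid argument meets both difficulties: it uses the separation on two
    legal inputs only, and merely runs the algorithm on the zero array, where nothing but the inner
    blocks varies. The resulting guess is right only with probability of order 1/T^2, which an
    additive adversary argument, excluding constant success, would not contradict; hence the
    multiplicative progress function. The constant 5/9 is a Schur complement: in the splitting by
    the value of f, [Gam / lam] is off-diagonal of norm at most 1, so 5 I - 4 Gam / lam dominates 5
    - 16/5 = 9/5 on either block. Duality is obtained without a separation theorem. The violation of
    the constraints is minimised in the least squares sense over the vectors themselves, and the
    residuals at a minimiser are the multipliers that make up the adversary matrix. *)

Section InnerProduct.
Variable R : realType.
Local Notation C := R[i].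
Implicit Types S K : finType.

Definition ip S (u v : S -> C) : C := \sum_s (u s)^* * v s.
Definition sqn S (u : S -> C) : C := \sum_s `|u s| ^+ 2.

Lemma sqnE S (u : S -> C) : sqn u = ip u u.
Proof. by apply: eq_bigr => s _; rewrite normCK mulrC. Qed.

Lemma sqn_ge0 S (u : S -> C) : 0 <= sqn u.
Proof. by apply: sumr_ge0 => s _; rewrite exprn_ge0. Qed.

Lemma ipC S (u v : S -> C) : ip v u = (ip u v)^*.
Proof.
rewrite /ip rmorph_sum; apply: eq_bigr => s _.
by rewrite rmorphM /= conjCK mulrC.
Qed.

Lemma ip_sumr S (I : finType) (c : I -> C) (u : S -> C) (v : I -> S -> C) :
  ip u (fun s => \sum_i c i * v i s) = \sum_i c i * ip u (v i).
Proof.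
rewrite /ip; under eq_bigr do rewrite mulr_sumr.
rewrite exchange_big /=; apply: eq_bigr => i _; rewrite mulr_sumr.
by apply: eq_bigr => s _; rewrite mulrCA.
Qed.

Lemma ipDr S (u v w : S -> C) :
  ip u (fun s => v s + w s) = ip u v + ip u w.
Proof. by rewrite /ip -big_split; apply: eq_bigr => s _; rewrite /= mulrDr. Qed.

Lemma ipZr S (u v : S -> C) c : ip u (fun s => c * v s) = c * ip u v.
Proof. by rewrite /ip mulr_sumr; apply: eq_bigr => s _; rewrite mulrCA. Qed.

Lemma ipBr S (u v w : S -> C) :
  ip u (fun s => v s - w s) = ip u v - ip u w.
Proof. by rewrite /ip -sumrB; apply: eq_bigr => s _; rewrite /= mulrBr. Qed.

Lemma ipDl S (u v w : S -> C) :
  ip (fun s => v s + w s) u = ip v u + ip w u.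
Proof. by rewrite !(ipC u) ipDr rmorphD /= -!ipC. Qed.

Lemma ipBl S (u v w : S -> C) :
  ip (fun s => v s - w s) u = ip v u - ip w u.
Proof. by rewrite !(ipC u) ipBr rmorphB /= -!ipC. Qed.

Lemma ipZl S (u v : S -> C) c : ip (fun s => c * v s) u = c^* * ip v u.
Proof. by rewrite !(ipC u) ipZr rmorphM /= -!ipC. Qed.

Lemma sqn_eq0 S (u : S -> C) : sqn u = 0 -> forall s, u s = 0.
Proof.
move/eqP; rewrite psumr_eq0 => [/allP h s|s _]; last by rewrite exprn_ge0.
by move: (h s (mem_index_enum s)) => /=; rewrite expf_eq0 /= normr_eq0 => /eqP.
Qed.

Lemma sqnZ S (u : S -> C) c : sqn (fun s => c * u s) = `|c| ^+ 2 * sqn u.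
Proof. by rewrite /sqn mulr_sumr; apply: eq_bigr => s _; rewrite normrM exprMn. Qed.

(** The two sides, after the triangle inequality, differ by t^-1 (|a| - t |b|)^2. The free weight
    [t] becomes the step number in [run_diff], so that errors of T steps cost a factor T and not
    2^T. *)
Lemma normD_sq (a b t : C) : 0 < t ->
  `|a + b| ^+ 2 <= (1 + t^-1) * `|a| ^+ 2 + (1 + t) * `|b| ^+ 2.
Proof.
move=> t0; have h := ler_normD a b.
have ha := normr_ge0 a; have hb := normr_ge0 b.
apply: (@le_trans _ _ ((`|a| + `|b|) ^+ 2)); first by rewrite lerXn2r // nnegrE // addr_ge0.
have e : (1 + t^-1) * `|a| ^+ 2 + (1 + t) * `|b| ^+ 2 - (`|a| + `|b|) ^+ 2
   = t^-1 * (`|a| - t * `|b|) ^+ 2.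
  by field; rewrite gt_eqF.
rewrite -subr_ge0 e mulr_ge0 ?invr_ge0 ?(ltW t0) // real_exprn_even_ge0 //.
by rewrite rpredB // ?rpredM // ger0_real // ltW.
Qed.

Lemma sqnD S (u v : S -> C) t : 0 < t ->
  sqn (fun s => u s + v s) <= (1 + t^-1) * sqn u + (1 + t) * sqn v.
Proof.
move=> t0; rewrite /sqn !mulr_sumr -big_split; apply: ler_sum => s _.
exact: normD_sq.
Qed.

Lemma sqnN S (u : S -> C) : sqn (fun s => - u s) = sqn u.
Proof. by apply: eq_bigr => s _; rewrite normrN. Qed.

Lemma sqnB2 S (u v : S -> C) :
  sqn (fun s => u s - v s) <= 2 * (sqn u + sqn v).
Proof.
have := @sqnD S u (fun s => - v s) 1 ltr01.
by rewrite sqnN invr1 -mulrDr.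
Qed.

(* weighted AM-GM in place of Cauchy-Schwarz *)
Lemma norm_ip_le S (u v : S -> C) t : 0 < t ->
  `|ip u v| <= (t * sqn u + t^-1 * sqn v) / 2.
Proof.
move=> t0; apply: le_trans (ler_norm_sum _ _ _) _.
rewrite /sqn !mulr_sumr -big_split mulr_suml; apply: ler_sum => s _ /=.
rewrite normrM norm_conjC -subr_ge0.
have -> : (t * `|u s| ^+ 2 + t^-1 * `|v s| ^+ 2) / 2 - `|u s| * `|v s| =
  t^-1 / 2 * (t * `|u s| - `|v s|) ^+ 2 by field; rewrite gt_eqF.
rewrite mulr_ge0 ?divr_ge0 ?invr_ge0 ?(ltW t0) // real_exprn_even_ge0 //.
by rewrite rpredB // ?rpredM // ger0_real // ltW.
Qed.

Lemma mapplyD S (A : op R S) u v :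
  mapply A (fun s => u s + v s) = fun s => mapply A u s + mapply A v s.
Proof.
by apply/funext => s; rewrite /mapply -big_split; apply: eq_bigr => t _; rewrite /= mulrDr.
Qed.

Lemma mapplyB S (A : op R S) u v :
  mapply A (fun s => u s - v s) = fun s => mapply A u s - mapply A v s.
Proof.
by apply/funext => s; rewrite /mapply -sumrB; apply: eq_bigr => t _; rewrite /= mulrBr.
Qed.

Lemma mapplyZ S (A : op R S) c u :
  mapply A (fun s => c * u s) = fun s => c * mapply A u s.
Proof.
by apply/funext => s; rewrite /mapply mulr_sumr; apply: eq_bigr => t _; rewrite /= mulrCA.
Qed.

Lemma unitary_ip S (U : op R S) u v : unitary U ->
  ip (mapply U u) (mapply U v) = ip u v.
Proof.
move=> hU; rewrite /ip.
transitivity (\sum_r \sum_s \sum_t (u s)^* * v t * ((U r s)^* * U r t)).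
  apply: eq_bigr => r _; rewrite /mapply rmorph_sum mulr_suml.
  apply: eq_bigr => s _; rewrite mulr_sumr; apply: eq_bigr => t _.
  by rewrite rmorphM /=; ring.
transitivity (\sum_s \sum_t (u s)^* * v t * \sum_r (U r s)^* * U r t).
  rewrite exchange_big; apply: eq_bigr => s _ /=.
  rewrite exchange_big; apply: eq_bigr => t _ /=.
  by rewrite mulr_sumr.
apply: eq_bigr => s _; rewrite (bigD1 s) //= hU eqxx mulr1 big1 ?addr0 // => t ts.
by rewrite hU eq_sym (negbTE ts) mulr0.
Qed.

Lemma unitary_sqn S (U : op R S) u : unitary U -> sqn (mapply U u) = sqn u.
Proof. by move=> hU; rewrite !sqnE unitary_ip. Qed.

Definition comp_op S (A B : op R S) : op R S := fun s t => \sum_r A s r * B r t.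

Lemma mapply_comp S (A B : op R S) v : mapply (comp_op A B) v = mapply A (mapply B v).
Proof.
apply/funext => s; rewrite /mapply /comp_op.
under eq_bigr do rewrite mulr_suml; rewrite exchange_big; apply: eq_bigr => r _.
by rewrite mulr_sumr; apply: eq_bigr => t _; rewrite mulrA.
Qed.

Lemma mapply_basis S (A : op R S) t : mapply A (basis_vec R t) = fun s => A s t.
Proof.
apply/funext => s; rewrite /mapply (bigD1 t) //= /basis_vec eqxx mulr1.
by rewrite big1 ?addr0 // => r /negbTE ->; rewrite mulr0.
Qed.

Lemma ip_basisl S (s : S) v : ip (basis_vec R s) v = v s.
Proof.
rewrite /ip (bigD1 s) //= /basis_vec eqxx rmorph1 mul1r.
by rewrite big1 ?addr0 // => r /negbTE ->; rewrite rmorph0 mul0r.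
Qed.

Lemma isometry_unitary S (U : op R S) :
  (forall u v, ip (mapply U u) (mapply U v) = ip u v) -> unitary U.
Proof.
move=> h s t; have := h (basis_vec R s) (basis_vec R t).
by rewrite !mapply_basis ip_basisl.
Qed.

Lemma unitary_comp S (A B : op R S) : unitary A -> unitary B -> unitary (comp_op A B).
Proof.
by move=> hA hB; apply: isometry_unitary => u v; rewrite !mapply_comp !unitary_ip.
Qed.

Lemma sqn_basis S (s : S) : sqn (basis_vec R s) = 1.
Proof. by rewrite sqnE ip_basisl /basis_vec eqxx. Qed.

End InnerProduct.

(** * Tensor products of positive semidefinite forms *)

Section TensorPsd.
Variable R : realType.
Local Notation C := R[i].
Implicit Types F : finType.

Definition form F (K : F -> F -> C) (g : F -> C) : C :=
  \sum_x \sum_y (g x)^* * K x y * g y.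

Definition rform F (K : F -> F -> R) (w : F -> R) : R :=
  \sum_x \sum_y w x * K x y * w y.

Definition rpsd F (K : F -> F -> R) : Prop :=
  (forall x y, K x y = K y x) /\ forall w, 0 <= rform K w.

Lemma conj_real (a : R) : (a%:C%C : C)^* = a%:C%C.
Proof. by apply/conj_Creal; rewrite realE lecR lecR -realE num_real. Qed.

(** With [g] split into real and imaginary parts, the cross terms cancel because [K] is
    symmetric. *)
Lemma rpsd_form F (K : F -> F -> R) g : rpsd K ->
  0 <= form (fun x y => (K x y)%:C%C) g.
Proof.
case=> sK hK.
pose a x := complex.Re (g x); pose b x := complex.Im (g x).
have e x : g x = (a x)%:C%C + 'i%C * (b x)%:C%C by exact: complexE.
suff -> : form (fun x y => (K x y)%:C%C) g = (rform K a + rform K b)%:C%C.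
  by rewrite lecR addr_ge0.
have ei : ('i%C : C)^* = - 'i%C by apply/eqP; rewrite eq_complex /= oppr0 !eqxx.
have i2 : ('i%C : C) * 'i%C = -1.
  by rewrite -expr2 sqr_i.
have E : form (fun x y => (K x y)%:C%C) g =
  \sum_x \sum_y ((a x * K x y * a y + b x * K x y * b y)%:C%C
       + 'i%C * (a x * K x y * b y)%:C%C - 'i%C * (b x * K x y * a y)%:C%C).
  apply: eq_bigr => x _; apply: eq_bigr => y _.
  rewrite !e rmorphD rmorphM /= !conj_real ei !(rmorphD, rmorphM) /=.
  transitivity ((a x)%:C%C * (K x y)%:C%C * (a y)%:C%C
     - ('i%C * 'i%C) * ((b x)%:C%C * (K x y)%:C%C * (b y)%:C%C)
     + 'i%C * ((a x)%:C%C * (K x y)%:C%C * (b y)%:C%C)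
     - 'i%C * ((b x)%:C%C * (K x y)%:C%C * (a y)%:C%C) : C); first by ring.
  by rewrite i2; ring.
rewrite E.
under eq_bigr => x _ do rewrite sumrB big_split /=.
rewrite sumrB big_split /=.
have -> : \sum_x \sum_y 'i%C * (b x * K x y * a y)%:C%C
   = \sum_x \sum_y 'i%C * (a x * K x y * b y)%:C%C :> C.
  rewrite exchange_big; apply: eq_bigr => x _; apply: eq_bigr => y _.
  by rewrite sK; congr (_ * _%:C%C); ring.
rewrite addrK rmorphD /rform !rmorph_sum -big_split; apply: eq_bigr => x _ /=.
by rewrite !rmorph_sum -big_split; apply: eq_bigr => y _ /=; rewrite rmorphD.
Qed.

(** Spectral theorem: the rows of [Y] are eigenvectors scaled by the square roots of the
    eigenvalues, which are nonnegative because each is the value of the form at its eigenvector. *)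
Lemma gram_of_psd F (K : F -> F -> C) :
  (forall x y, K y x = (K x y)^*) -> (forall g, 0 <= form K g) ->
  exists Y : 'I_#|F| -> F -> C,
    forall x y, K x y = \sum_m (Y m x)^* * Y m y.
Proof.
move=> hK pK.
pose A := \matrix_(i < #|F|, j < #|F|) K (enum_val i) (enum_val j).
have hA : A \is hermsymmx.
  apply/is_hermitianmxP; rewrite expr0 scale1r; apply/matrixP => i j.
  by rewrite !mxE hK.
have /orthomx_spectralP := hermitian_normalmx hA.
set P := spectralmx A; set d := spectral_diag A => eA.
have uP : P \is unitarymx by exact: spectral_unitarymx.
have EA i j : A i j = \sum_m (P m i)^* * d 0 m * P m j.
  rewrite eA (invmx_unitary uP) !mxE; apply: eq_bigr => m _.
  rewrite mul_mx_diag !mxE //.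
have EK x y : K x y = \sum_m (P m (enum_rank x))^* * d 0 m * P m (enum_rank y).
  by rewrite -EA mxE !enum_rankK.
have PP m m' : \sum_x P m (enum_rank x) * (P m' (enum_rank x))^* = (m == m')%:R.
  have /unitarymxP/matrixP/(_ m m') := uP; rewrite !mxE => <-.
  rewrite (reindex enum_rank) /=; last by apply: onW_bij; exact: enum_rank_bij.
  by apply: eq_bigr => x _; rewrite !mxE.
have d0 m0 : 0 <= d 0 m0.
  have := pK (fun x => (P m0 (enum_rank x))^*).
  suff -> : form K (fun x => (P m0 (enum_rank x))^*) = d 0 m0 by [].
  rewrite /form.
  transitivity (\sum_m d 0 m * ((\sum_x P m0 (enum_rank x) * (P m (enum_rank x))^*) *
     \sum_y P m (enum_rank y) * (P m0 (enum_rank y))^*)).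
    transitivity (\sum_x \sum_y \sum_m (d 0 m * (P m0 (enum_rank x) * (P m (enum_rank x))^*)
         * (P m (enum_rank y) * (P m0 (enum_rank y))^*))).
      apply: eq_bigr => x _; apply: eq_bigr => y _.
      rewrite EK conjCK mulr_sumr mulr_suml; apply: eq_bigr => m _; ring.
    under eq_bigr do rewrite exchange_big /=.
    rewrite exchange_big; apply: eq_bigr => m _ /=.
    rewrite mulr_suml mulr_sumr; apply: eq_bigr => x _.
    by rewrite !mulr_sumr; apply: eq_bigr => y _; ring.
  rewrite (bigD1 m0) //= !PP eqxx !mulr1 big1 ?addr0 // => m mm.
  by rewrite !PP eq_sym (negbTE mm) mul0r mulr0.
exists (fun m x => sqrtC (d 0 m) * P m (enum_rank x)) => x y.
rewrite EK; apply: eq_bigr => m _; rewrite rmorphM /=.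
have -> : (sqrtC (d 0 m))^* = sqrtC (d 0 m).
  by apply/conj_Creal; rewrite ger0_real // sqrtC_ge0.
by rewrite -[in LHS](sqrtCK (d 0 m)); ring.
Qed.

(** Products of Gram vectors are Gram vectors of the product kernel, so the form is a squared norm
    indexed by k-tuples of Gram indices. *)
Lemma tensor_psd F k (K : 'I_k -> F -> F -> R) (g : {ffun 'I_k -> F} -> C) :
  (forall l, rpsd (K l)) ->
  0 <= form (fun z z' : {ffun 'I_k -> F} => (\prod_l K l (z l) (z' l))%:C%C) g.
Proof.
move=> hK.
have /choice [Y hY] l : exists Y : 'I_#|F| -> F -> C,
    forall x y, (K l x y)%:C%C = \sum_m (Y m x)^* * Y m y.
  apply: gram_of_psd => [x y|h]; last exact: rpsd_form.
  by rewrite conj_real; case: (hK l) => ->.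
suff -> : form (fun z z' : {ffun 'I_k -> F} => (\prod_l K l (z l) (z' l))%:C%C) g =
  sqn (fun I : {ffun 'I_k -> 'I_#|F|} => \sum_(z : {ffun 'I_k -> F}) (\prod_l Y l (I l) (z l)) * g z).
  exact: sqn_ge0.
rewrite /sqn /form.
transitivity (\sum_(z : {ffun 'I_k -> F}) \sum_(z' : {ffun 'I_k -> F}) \sum_(I : {ffun 'I_k -> 'I_#|F|})
   (((\prod_l Y l (I l) (z l)) * g z)^* * ((\prod_l Y l (I l) (z' l)) * g z'))).
  apply: eq_bigr => z _; apply: eq_bigr => z' _.
  have -> : ((\prod_l K l (z l) (z' l))%:C%C : C) =
      \prod_l \sum_m (Y l m (z l))^* * Y l m (z' l).
    by rewrite rmorph_prod; apply: eq_bigr => l _; exact: hY.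
  rewrite bigA_distr_bigA /= mulr_sumr mulr_suml; apply: eq_bigr => I _.
  by rewrite rmorphM rmorph_prod big_split /=; ring.
under eq_bigr do rewrite exchange_big /=.
rewrite exchange_big; apply: eq_bigr => I _ /=.
rewrite normCK mulrC rmorph_sum mulr_suml; apply: eq_bigr => z _.
by rewrite mulr_sumr.
Qed.

End TensorPsd.

(** * Adversary matrices *)

Definition sumsq (R : realType) (F : finType) (w : F -> R) : R := \sum_x w x ^+ 2.

(* [Gam] is a spectral adversary matrix for [g] (the entries of [Gam]
   with [x i = y i] are masked out in the third clause), [lam] its largest
   eigenvalue and [del] a unit vector attaining it. *)
Definition adversary (R : realType) n (g : pfun n) (Gam : bits n -> bits n -> R)
    (lam : R) (del : bits n -> R) : Prop :=
  [/\ 0 < lam /\ (forall x y, Gam x y = Gam y x),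
      (forall x y, Gam x y != 0 -> exists b, g x = Some b /\ g y = Some (~~ b)),
      (forall i w, rform (fun x y : bits n => (x i != y i)%:R * Gam x y) w <= sumsq w),
      (forall w, rform Gam w <= lam * sumsq w)
    & sumsq del = 1 /\ rform Gam del = lam].

Section TensorOrder.
Variable R : realType.
Local Notation C := R[i].
Implicit Types F : finType.

Definition tker F k (K : 'I_k -> F -> F -> R) (z z' : {ffun 'I_k -> F}) : C :=
  (\prod_l K l (z l) (z' l))%:C%C.

(** Expand every factor as B = A + (B - A). Each of the 2^k mixed products is positive semidefinite,
    and the one with [A] everywhere is the left side. *)
Lemma tensor_le F k (A B : 'I_k -> F -> F -> R) (g : {ffun 'I_k -> F} -> C) :
  (forall l, rpsd (A l)) -> (forall l, rpsd (fun x y => B l x y - A l x y)) ->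
  form (tker A) g <= form (tker B) g.
Proof.
move=> hA hD.
pose M (s : {ffun 'I_k -> bool}) l := if s l then A l else (fun x y => B l x y - A l x y).
have hM s : 0 <= form (tker (M s)) g.
  by apply: tensor_psd => l; rewrite /M; case: (s l).
have -> : form (tker B) g = \sum_s form (tker (M s)) g.
  rewrite /form [RHS]exchange_big; apply: eq_bigr => z _ /=.
  rewrite [RHS]exchange_big; apply: eq_bigr => z' _ /=.
  rewrite -mulr_suml -mulr_sumr; congr (_ * _ * _).
  rewrite /tker -rmorph_sum /=; congr (_%:C%C).
  transitivity (\prod_l \sum_(b : bool) (if b then A l else (fun x y => B l x y - A l x y)) (z l) (z' l)).
    by apply: eq_bigr => l _; rewrite big_bool /= addrC subrK.
  by rewrite bigA_distr_bigA.
rewrite (bigD1 [ffun=> true]) //=.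
have -> : tker (M [ffun=> true]) = tker A.
  apply/funext => z; apply/funext => z'; congr (_%:C%C).
  by apply: eq_bigr => l _; rewrite /M ffunE.
by rewrite lerDl sumr_ge0.
Qed.

Lemma form_scale F k c (K : 'I_k -> F -> F -> R) (g : {ffun 'I_k -> F} -> C) :
  form (tker (fun l x y => c * K l x y)) g = (c ^+ k)%:C%C * form (tker K) g.
Proof.
rewrite /form mulr_sumr; apply: eq_bigr => z _; rewrite mulr_sumr; apply: eq_bigr => z' _.
rewrite /tker big_split /= prodr_const card_ord rmorphM /=; ring.
Qed.

(** Passes to the |+>, |-> basis of the answer bit, in which a query fixes the sum and multiplies
    the difference by (-1)^(x_i). *)
Lemma form_parallelogram F (K : F -> F -> C) (g h : F -> C) :
  form K g + form K h =
  2^-1 * (form K (fun z => g z + h z) + form K (fun z => g z - h z)).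
Proof.
rewrite /form -!big_split mulr_sumr; apply: eq_bigr => x _ /=.
rewrite -!big_split mulr_sumr; apply: eq_bigr => y _ /=.
rewrite rmorphD rmorphB /=; field; by rewrite ?pnatr_eq0.
Qed.

End TensorOrder.

Section AdversaryForms.
Variables (R : realType) (n : nat) (g : pfun n) (Gam : bits n -> bits n -> R).
Variables (lam : R) (del : bits n -> R).
Hypothesis adv : adversary g Gam lam del.

Let lam0 : 0 < lam. Proof. by case: adv => -[]. Qed.
Let GamC x y : Gam x y = Gam y x. Proof. by case: adv => -[]. Qed.

(** Shifted so that its least eigenvalue is 1, attained at [del]: the progress then starts at 1, and
    an error bounded by [sumsq w] is absorbed by the form itself. *)
Definition mult_adv (x y : bits n) : R := 5 * (x == y)%:R - 4 / lam * Gam x y.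

Lemma rform_diag (F : finType) (p w : F -> R) :
  rform (fun x y => (x == y)%:R * p x) w = \sum_x p x * w x ^+ 2.
Proof.
apply: eq_bigr => x _; rewrite (bigD1 x) //= eqxx big1 ?addr0 => [|y /negbTE yx]; first by rewrite /=; ring.
by rewrite eq_sym yx /=; ring.
Qed.

Lemma rform_lin (F : finType) (A B : F -> F -> R) a b w :
  rform (fun x y => a * A x y + b * B x y) w = a * rform A w + b * rform B w.
Proof.
rewrite /rform !mulr_sumr -big_split; apply: eq_bigr => x _ /=.
by rewrite !mulr_sumr -big_split; apply: eq_bigr => y _ /=; ring.
Qed.

Lemma rform_ext (F : finType) (A B : F -> F -> R) w :
  (forall x y, A x y = B x y) -> rform A w = rform B w.
Proof. by move=> h; apply: eq_bigr => x _; apply: eq_bigr => y _; rewrite h. Qed.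

Lemma rform_mult_adv w : rform mult_adv w = 5 * sumsq w - 4 / lam * rform Gam w.
Proof.
rewrite -mulNr /sumsq -(eq_bigr _ (fun x _ => mul1r (w x ^+ 2))).
rewrite -(rform_diag (fun=> 1)) -rform_lin; apply: rform_ext => x y.
by rewrite /mult_adv mulr1 mulNr.
Qed.

Lemma rform_mult_adv_ge w : sumsq w <= rform mult_adv w.
Proof.
rewrite rform_mult_adv; case: adv => _ _ _ /(_ w) h _.
have : 4 / lam * rform Gam w <= 4 * sumsq w.
  by rewrite -mulrA ler_pM2l // mulrC ler_pdivrMr // mulrC.
lra.
Qed.

Lemma sumsq_ge0 (F : finType) (w : F -> R) : 0 <= sumsq w.
Proof. by apply: sumr_ge0 => x _; apply: sqr_ge0. Qed.

Lemma mult_adv_psd : rpsd mult_adv.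
Proof.
split=> [x y|w]; first by rewrite /mult_adv eq_sym GamC.
exact: le_trans (sumsq_ge0 w) (rform_mult_adv_ge w).
Qed.

Lemma rform_mult_adv_del : rform mult_adv del = 1.
Proof.
rewrite rform_mult_adv; case: adv => _ _ _ _ [-> ->].
by rewrite divfK ?gt_eqF //; lra.
Qed.

Definition flip_sign (i : 'I_n) (x : bits n) : R := if x i then -1 else 1.

Lemma rform_flip (K : bits n -> bits n -> R) i w :
  rform (fun x y => flip_sign i x * K x y * flip_sign i y) w =
  rform K (fun x => flip_sign i x * w x).
Proof. by apply: eq_bigr => x _; apply: eq_bigr => y _; ring. Qed.

Lemma flip_psd (K : bits n -> bits n -> R) i : rpsd K ->
  rpsd (fun x y => flip_sign i x * K x y * flip_sign i y).
Proof.
by case=> sK hK; split=> [x y|w]; rewrite ?rform_flip // sK; ring.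
Qed.

(** Conjugating by the signs (-1)^(x_i) only changes entries with x_i <> y_i, by 8 / lam times the
    masked [Gam]. That part is at most [sumsq w], hence at most the form of [mult_adv]. *)
Lemma query_psd i :
  rpsd (fun x y => (1 + 8 / lam) * mult_adv x y
                   - flip_sign i x * mult_adv x y * flip_sign i y).
Proof.
split=> [x y|w].
  by have [-> _] := mult_adv_psd; ring.
have -> : rform (fun x y => (1 + 8 / lam) * mult_adv x y
                   - flip_sign i x * mult_adv x y * flip_sign i y) w =
   8 / lam * rform mult_adv w
   + - (8 / lam) * rform (fun x y : bits n => (x i != y i)%:R * Gam x y) w.
  rewrite -rform_lin; apply: rform_ext => x y.
  rewrite /mult_adv /flip_sign; case: (eqVneq x y) => [->|_].
    by rewrite eqxx; case: (y i) => /=; field; rewrite gt_eqF.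
  by case: (x i); case: (y i) => /=; field; rewrite gt_eqF.
rewrite mulNr -mulrBr mulr_ge0 //; first by rewrite divr_ge0 // ltW.
rewrite subr_ge0.
case: adv => _ _ /(_ i w) h _ _; exact: le_trans h (rform_mult_adv_ge w).
Qed.

Definition guess_ker (b : bool) (x y : bits n) : R :=
  (x == y)%:R * (g x == Some b)%:R.

Lemma guess_ker_psd b : rpsd (guess_ker b).
Proof.
split=> [x y|w].
  by rewrite /guess_ker eq_sym; case: eqVneq => [->|_] //; rewrite !mul0r.
by rewrite rform_diag sumr_ge0 // => x _; rewrite mulr_ge0 ?sqr_ge0 ?ler0n.
Qed.

(* [Gam] only links [g = b] to [g = ~~ b], so rescaling the two parts of [w] by
   4 and 5 multiplies its form by 20. *)
Lemma guess_psd b : rpsd (fun x y => 5 / 9 * mult_adv x y - guess_ker b x y).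
Proof.
split=> [x y|w].
  by have [-> _] := mult_adv_psd; have [-> _] := guess_ker_psd b.
pose c x : R := if g x == Some b then 4 else if g x == Some (~~ b) then 5 else 0.
have e : rform Gam (fun x => c x * w x) = 20 * rform Gam w.
  rewrite /rform mulr_sumr; apply: eq_bigr => x _; rewrite mulr_sumr; apply: eq_bigr => y _.
  have [->|nz] := eqVneq (Gam x y) 0; first by rewrite !(mulr0, mul0r).
  case: adv => _ /(_ x y nz) [b' [ex ey]] _ _ _.
  rewrite /c ex ey; case: (b') (b) => -[] /=; ring.
case: adv => _ _ _ /(_ (fun x => c x * w x)); rewrite e => h _.
rewrite (_ : rform _ _ = 5 / 9 * rform mult_adv w + -1 * rform (guess_ker b) w); last first.
  by rewrite -rform_lin; apply: rform_ext => x y; ring.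
rewrite rform_mult_adv rform_diag.
have h' : 4 / lam * rform Gam w <= 5^-1 * sumsq (fun x => c x * w x).
  rewrite -(ler_pM2r lam0) [leLHS](_ : _ = 4 * rform Gam w); last by field; rewrite gt_eqF.
  lra.
suff : \sum_x (g x == Some b)%:R * w x ^+ 2 <=
   25 / 9 * sumsq w - 9^-1 * sumsq (fun x => c x * w x) by lra.
rewrite /sumsq !mulr_sumr -sumrB; apply: ler_sum => x _.
rewrite /c; have := sqr_ge0 (w x).
case: (g x == Some b) => /=; first by move=> ?; rewrite exprMn; lra.
by case: (g x == _) => /= ?; rewrite exprMn; lra.
Qed.

(** Cutting [del] off outside the domain keeps its [Gam] form, so by maximality of [lam] it cannot
    decrease the norm. *)
Lemma del_support x : g x = None -> del x = 0.
Proof.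
move=> gx; pose w y := (g y != None)%:R * del y.
have e : rform Gam w = rform Gam del.
  rewrite /rform; apply: eq_bigr => y _; apply: eq_bigr => y' _.
  have [->|nz] := eqVneq (Gam y y') 0; first by rewrite !(mulr0, mul0r).
  by case: adv => _ /(_ y y' nz) [b' [ex ey]] _ _ _; rewrite /w ex ey !mul1r.
case: adv => _ _ _ /(_ w) + [d1 d2]; rewrite e d2 -[leLHS]mulr1 ler_pM2l // -d1.
rewrite -subr_le0 /sumsq -sumrB => h.
have hp y : 0 <= del y ^+ 2 - w y ^+ 2.
  rewrite /w; have := sqr_ge0 (del y).
  by case: (g y == None) => /=; rewrite ?mul0r ?mul1r ?subrr // expr0n subr0.
have /eqP : \sum_y (del y ^+ 2 - w y ^+ 2) = 0.
  by apply/eqP; rewrite eq_le h sumr_ge0.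
rewrite psumr_eq0 => [/allP /(_ x (mem_index_enum x))/=|y _]; last exact: hp.
by rewrite /w gx eqxx mul0r expr0n subr0 sqrf_eq0 => /eqP.
Qed.

End AdversaryForms.

(** * The direct product bound *)

Section Oracle.
Variables (R : realType) (N : nat) (W : finType).
Local Notation C := R[i].

Lemma mapply_oracle (x : bits N) (v : Sp N W -> C) s :
  mapply (@oracle R N W x) v s = v ((s.1.1, s.1.2 (+) x s.1.1), s.2).
Proof.
rewrite /mapply (bigD1 (((s.1.1, s.1.2 (+) x s.1.1), s.2) : Sp N W)) //= /oracle /=.
rewrite !eqxx /= -addbA addbb addbF eqxx mul1r big1 ?addr0 // => -[[i b] w] /=.
case: s => -[i' b'] w' /=; rewrite !xpair_eqE => ne.
have [ei|] := eqVneq i' i; last by rewrite mul0r.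
rewrite -ei in ne *.
have [ew|] := eqVneq w' w; last by rewrite andbF mul0r.
have [eb|] := eqVneq b' (b (+) x i'); last by rewrite mul0r.
by move: ne; rewrite ew eb -addbA addbb addbF !eqxx.
Qed.

Lemma sum_Sp (F : Sp N W -> C) :
  \sum_s F s = \sum_(p : 'I_N * W) (F ((p.1, false), p.2) + F ((p.1, true), p.2)).
Proof.
transitivity (\sum_(p : 'I_N * W) \sum_(b : bool) F ((p.1, b), p.2)); last first.
  by apply: eq_bigr => p _; rewrite big_bool addrC.
rewrite pair_big /= (reindex (fun q : ('I_N * W) * bool => ((q.1.1, q.2), q.1.2) : Sp N W)) //=.
by exists (fun s => ((s.1.1, s.2), s.1.2)) => [[[? ?] ?]|[[? ?] ?]].
Qed.

Lemma ip_oracle (x : bits N) (u v : Sp N W -> C) :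
  ip (mapply (oracle R x) u) (mapply (oracle R x) v) = ip u v.
Proof.
rewrite /ip !sum_Sp; apply: eq_bigr => p _; rewrite !mapply_oracle /=.
by case: (x p.1) => //=; rewrite addrC.
Qed.

Lemma sqn_oracle (x : bits N) (u : Sp N W -> C) : sqn (mapply (oracle R x) u) = sqn u.
Proof. by rewrite !sqnE ip_oracle. Qed.

Lemma sqn_run U (init : Sp N W) x T : (forall t, (t <= T)%N -> unitary (U t)) ->
  forall t, (t <= T)%N -> sqn (@run R N W U init x t) = 1.
Proof.
move=> hU; elim=> [|t IH] tT /=; (rewrite unitary_sqn; last exact: hU).
  exact: sqn_basis.
by rewrite sqn_oracle IH // ltnW.
Qed.

End Oracle.

Section DirectProduct.
Variables (R : realType) (n : nat) (g : pfun n) (Gam : bits n -> bits n -> R).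
Variables (lam : R) (del : bits n -> R).
Hypothesis adv : adversary g Gam lam del.
Variables (k N : nat) (W : finType).
Local Notation C := R[i].
Local Notation Z := {ffun 'I_k -> bits n}.
Variable inp : Z -> bits N.
Hypothesis inp_bit : forall i : 'I_N,
  (exists (l : 'I_k) (j : 'I_n), forall z, inp z i = z l j) \/
  (exists c, forall z, inp z i = c).

Definition del_prod (z : Z) : R := \prod_l del (z l).

Let K : Z -> Z -> C := tker (fun=> mult_adv Gam lam).

(** Expectation of the k-fold tensor power of [mult_adv] on an input register in the superposition
    [del_prod], entangled with the algorithm's state. *)
Definition progress (psi : Z -> Sp N W -> C) : C :=
  \sum_s form K (fun z => (del_prod z)%:C%C * psi z s).

(** A query position lies in at most one block, so only one tensor factor is conjugated by signs and
    the loss 1 + 8 / lam occurs once, whatever [k] is. *)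
Lemma form_sign_le i (h : Z -> C) :
  form K (fun z => (-1) ^+ inp z i * h z) <= (1 + 8 / lam)%:C%C * form K h.
Proof.
have hG := mult_adv_psd adv.
have lam0 : 0 < lam by case: adv => -[].
have K0 h' : 0 <= form K h' by apply: tensor_psd => _; exact: hG.
case: (inp_bit i) => [[l [j e]]|[c e]]; last first.
  have -> : form K (fun z => (-1) ^+ inp z i * h z) = form K h.
    apply: eq_bigr => z _; apply: eq_bigr => z' _; rewrite !e.
    by case: c {e} => /=; rewrite ?expr0 ?expr1 ?mul1r // rmorphM rmorphN1 /=; ring.
  rewrite rmorphD /= mulrDl mul1r lerDl mulr_ge0 // lecR divr_ge0 // ltW //.
pose A l' := if l' == l then (fun x y => flip_sign R j x * mult_adv Gam lam x y * flip_sign R j y)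
  else mult_adv Gam lam.
pose B l' := if l' == l then (fun x y => (1 + 8 / lam) * mult_adv Gam lam x y)
  else mult_adv Gam lam.
have <- : form (tker A) h = form K (fun z => (-1) ^+ inp z i * h z).
  apply: eq_bigr => z _; apply: eq_bigr => z' _.
  have -> : tker A z z' = ((flip_sign R j (z l))%:C%C * (flip_sign R j (z' l))%:C%C) * K z z'.
    rewrite /K /tker -!rmorphM /=; congr (_%:C%C).
    rewrite (bigD1 l) //= [in RHS](bigD1 l) //= /A eqxx.
    rewrite (eq_bigr (fun l => mult_adv Gam lam (z l) (z' l))); first by ring.
    by move=> l' /negbTE ->.
  rewrite !e /flip_sign rmorphM rmorphXn rmorphN1.
  by case: (z l j); case: (z' l j); rewrite /= ?expr0 ?expr1 ?rmorphN ?rmorph1 /=; ring.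
have <- : form (tker B) h = (1 + 8 / lam)%:C%C * form K h.
  rewrite /form mulr_sumr; apply: eq_bigr => z _; rewrite mulr_sumr; apply: eq_bigr => z' _.
  have -> : tker B z z' = (1 + 8 / lam)%:C%C * K z z'.
    rewrite /K /tker -!rmorphM /=; congr (_%:C%C).
    rewrite (bigD1 l) //= [in RHS](bigD1 l) //= /B eqxx.
    rewrite (eq_bigr (fun l => mult_adv Gam lam (z l) (z' l))); first by ring.
    by move=> l' /negbTE ->.
  ring.
apply: tensor_le => l'; rewrite /A /B; case: eqP => _ //.
- exact: flip_psd.
- exact: (query_psd adv).
split=> [x y|w]; first by rewrite !subrr.
by rewrite /rform big1 // => x _; rewrite big1 // => y _; rewrite subrr mulr0 mul0r.
Qed.

(** The progress depends on the states through their inner products alone, hence is invariant under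
    input-independent unitaries. *)
Lemma progress_gram psi : progress psi =
  \sum_z \sum_z' (del_prod z)%:C%C * K z z' * (del_prod z')%:C%C * ip (psi z) (psi z').
Proof.
rewrite /progress /form exchange_big; apply: eq_bigr => z _ /=.
rewrite exchange_big; apply: eq_bigr => z' _ /=.
rewrite /ip mulr_sumr; apply: eq_bigr => s _.
rewrite rmorphM /= conj_real; ring.
Qed.

Lemma progress_unitary (U : op R (Sp N W)) psi : unitary U ->
  progress (fun z => mapply U (psi z)) = progress psi.
Proof.
move=> hU; rewrite !progress_gram.
by apply: eq_bigr => z _; apply: eq_bigr => z' _; rewrite unitary_ip.
Qed.

Lemma progress_oracle psi :
  progress (fun z => mapply (oracle R (inp z)) (psi z)) <= (1 + 8 / lam)%:C%C * progress psi.
Proof.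
rewrite /progress !sum_Sp mulr_sumr; apply: ler_sum => -[i w] _ /=.
pose h b z := (del_prod z)%:C%C * psi z ((i, b), w).
rewrite -/(h false) -/(h true) [leLHS]form_parallelogram [in leRHS]form_parallelogram.
rewrite mulrCA ler_pM2l ?invr_gt0 ?ltr0n // mulrDr lerD //.
  rewrite (_ : (fun z => _ + _) = (fun z => h false z + h true z)); last first.
    apply/funext => z; rewrite !mapply_oracle /= /h; case: (inp z i) => //=.
    by rewrite addrC.
  apply: le_trans (_ : 1%:C%C * form K (fun z => h false z + h true z) <= _).
    by rewrite mul1r.
  apply: ler_wpM2r; first by apply: tensor_psd => _; exact: (mult_adv_psd adv).
  by rewrite lecR lerDl divr_ge0 // ltW //; case: adv => -[].
rewrite (_ : (fun z => _ - _) = (fun z => (-1) ^+ inp z i * (h false z - h true z))); last first.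
  apply/funext => z; rewrite !mapply_oracle /= /h; case: (inp z i) => /=.
    by rewrite expr1; ring.
  by rewrite expr0 mul1r.
exact: form_sign_le.
Qed.

Variables (U : nat -> op R (Sp N W)) (init : Sp N W) (T : nat).
Hypothesis unitU : forall t, (t <= T)%N -> unitary (U t).

Lemma form_del_prod : form K (fun z => (del_prod z)%:C%C) = 1.
Proof.
have -> : form K (fun z => (del_prod z)%:C%C) =
   (\prod_(l < k) rform (mult_adv Gam lam) del)%:C%C.
  rewrite /rform bigA_distr_bigA /= /form rmorph_sum; apply: eq_bigr => z _.
  rewrite bigA_distr_bigA /= rmorph_sum; apply: eq_bigr => z' _.
  by rewrite conj_real /K /tker -!rmorphM /= /del_prod !big_split.
by rewrite (rform_mult_adv_del adv) prodr_const expr1n.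
Qed.

Lemma progress_run t : (t <= T)%N ->
  progress (fun z => run U init (inp z) t) <= ((1 + 8 / lam) ^+ t)%:C%C.
Proof.
have lam0 : 0 < lam by case: adv => -[].
have c0 : 0 <= 1 + 8 / lam by rewrite addr_ge0 // divr_ge0 // ltW.
elim: t => [|t IH] tT.
  rewrite /= expr0 (progress_unitary (fun=> basis_vec R init)); last exact: unitU.
  rewrite progress_gram -[leRHS]/(1 : C) -form_del_prod /form le_eqVlt; apply/orP; left; apply/eqP.
  apply: eq_bigr => z _; apply: eq_bigr => z' _.
  by rewrite -sqnE sqn_basis conj_real mulr1.
rewrite /= (progress_unitary (fun z => mapply (oracle R (inp z)) (run U init (inp z) t))); last exact: unitU.
apply: le_trans (progress_oracle _) _.
rewrite exprS rmorphM /=; apply: ler_wpM2l; first by rewrite lecR.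
exact/IH/ltnW.
Qed.

(** For a fixed basis state the guess is a fixed string, so its success is the form of a tensor
    product of the diagonal kernels [guess_ker], each at most 5/9 of [mult_adv]. *)
Lemma direct_product (guess : Sp N W -> {ffun 'I_k -> bool}) t : (t <= T)%N ->
  \sum_z (del_prod z ^+ 2)%:C%C *
     \sum_(s | [forall l, g (z l) == Some (guess s l)]) `|run U init (inp z) t s| ^+ 2
  <= ((5 / 9) ^+ k * (1 + 8 / lam) ^+ t)%:C%C.
Proof.
move=> tT; rewrite rmorphM /=.
apply: le_trans (_ : ((5 / 9) ^+ k)%:C%C * progress (fun z => run U init (inp z) t) <= _); last first.
  apply: ler_wpM2l; last exact: progress_run.
  by rewrite lecR exprn_ge0 // divr_ge0.
rewrite /progress mulr_sumr.
under eq_bigr do rewrite big_mkcond mulr_sumr.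
rewrite exchange_big; apply: ler_sum => s _ /=.
rewrite -form_scale.
pose h (z : Z) := (del_prod z)%:C%C * run U init (inp z) t s.
rewrite -/h.
apply: (le_trans _ (@tensor_le R _ k (fun l => guess_ker R g (guess s l)) _ h _ _)) => [|l|l].
- rewrite le_eqVlt; apply/orP; left; apply/eqP.
  apply: eq_bigr => z _; rewrite (bigD1 z) //= big1 ?addr0 => [|z' zz].
    rewrite /tker; case: ifP => [/forallP hg|/negbT/forallPn [l /negbTE hl]].
      rewrite big1 => [|l _]; last by rewrite /guess_ker eqxx hg mul1r.
      have -> : (h z)^* = (del_prod z)%:C%C * (run U init (inp z) t s)^*.
        by rewrite /h rmorphM /= conj_real.
      by rewrite /h normCK rmorphXn /=; ring.
    by rewrite (bigD1 l) //= /guess_ker eqxx hl /= !(mulr0, mul0r, rmorph0).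
  rewrite /tker.
  have [l hl] : exists l, z l != z' l.
    apply/existsP; rewrite -negb_forall; apply: contra zz => /forallP e.
    by apply/eqP/ffunP => l; apply/esym/eqP.
  by rewrite (bigD1 l) //= /guess_ker (negbTE hl) /= !(mulr0, mul0r, rmorph0).
- exact: guess_ker_psd.
- exact: (guess_psd adv).
Qed.

End DirectProduct.

(** * Duality *)

Section ExtremeValue.
Local Open Scope classical_set_scope.
Variable R : realType.

Definition coords (I : finType) (v : 'rV[R]_#|I|) (i : I) : R := v ord0 (enum_rank i).

Lemma coords_surj (I : finType) (a : I -> R) : exists v, coords v = a.
Proof.
exists (\row_j a (enum_val j)); apply/funext => i.
by rewrite /coords mxE enum_rankK.
Qed.

Lemma attains_min (I : finType) (phi : (I -> R) -> R) (A : (I -> R) -> Prop) L :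
  continuous (fun v => phi (@coords I v)) -> closed [set v | A (@coords I v)] ->
  (exists a, A a) -> (forall a, A a -> forall i, `|a i| <= L) ->
  exists a, A a /\ forall b, A b -> phi a <= phi b.
Proof.
move=> cphi clA [a0 Aa0] bA.
pose K := [set v | A (@coords I v)].
have cK : compact K.
  apply: (subclosed_compact clA (@rV_compact _ _ (fun=> `[(- L), L]%classic) _)).
    by move=> _; apply: segment_compact.
  move=> v /bA h j /=.
  by rewrite in_itv /= -ler_norml -[j]enum_valK; exact: h.
have K0 : K !=set0.
  by case: (coords_surj a0) => v e; exists v; rewrite /K /= e.
have [c] := compact_EVT_min K0 cK (continuous_subspaceT cphi).
rewrite inE => Kc cmin; exists (coords c); split=> // b Ab.
have [v e] := coords_surj b; rewrite -e; apply: cmin.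
by rewrite inE /K /= e.
Qed.

Lemma continuous_sum (T : topologicalType) (J : finType) (f : J -> T -> R) :
  (forall j, continuous (f j)) -> continuous (fun v => \sum_j f j v).
Proof. by move=> h; apply: continuous_big => //; exact: add_continuous. Qed.

Lemma continuous_mul (T : topologicalType) (f h : T -> R) :
  continuous f -> continuous h -> continuous (fun v => f v * h v).
Proof. by move=> cf ch v; apply: cvgM; [exact: cf|exact: ch]. Qed.

Lemma continuous_add (T : topologicalType) (f h : T -> R) :
  continuous f -> continuous h -> continuous (fun v => f v + h v).
Proof. by move=> cf ch v; apply: cvgD; [exact: cf|exact: ch]. Qed.

Lemma continuous_opp (T : topologicalType) (f : T -> R) :
  continuous f -> continuous (fun v => - f v).
Proof. by move=> cf v; apply: cvgN; exact: cf. Qed.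

Lemma continuous_cst (T : topologicalType) (c : R) : continuous (fun _ : T => c).
Proof. by move=> v; exact: cvg_cst. Qed.

Lemma continuous_maxr (T : topologicalType) (f : T -> R) :
  continuous f -> continuous (fun v => Num.max (f v) 0).
Proof. move=> cf v; apply: (@continuous_max R T f (fun=> 0)); [exact: cf|exact: cvg_cst]. Qed.

Lemma continuous_coords (I : finType) i : continuous (fun v => @coords I v i).
Proof. exact: coord_continuous. Qed.

End ExtremeValue.

Lemma first_order_ge0 (R : realType) (a b : R) :
  (forall s, 0 < s -> s < 1 -> 0 <= s * a + s ^+ 2 * b) -> 0 <= a.
Proof.
move=> h; rewrite leNgt; apply/negP => a0.
(* Small enough that s < 1 and s b <= - a / 2, so the linear term would win. *)
pose s := (- a) / (2 * (`|b| + 1 - a)).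
have b0 := normr_ge0 b; have bb := ler_norm b.
have p0 : 0 < 2 * (`|b| + 1 - a) by lra.
have s0 : 0 < s by rewrite divr_gt0 //; lra.
have s1 : s < 1 by rewrite ltr_pdivrMr //; lra.
have sb : s * b <= - a / 2.
  apply: le_trans (_ : s * (`|b| + 1 - a) <= _); first by rewrite ler_pM2l //; lra.
  by rewrite /s le_eqVlt; apply/orP; left; apply/eqP; field; apply: lt0r_neq0; lra.
have := h s s0 s1; rewrite expr2 -mulrA -mulrDr pmulr_rge0 //; lra.
Qed.

(* Dual solutions of the adversary bound, one vector family serving both
   the 1-inputs and the 0-inputs. *)
Definition feasible (R : realType) N (g : pfun N) (d : R) : Prop :=
  exists (M : finType) (a : bits N -> 'I_N -> M -> R),
    (forall x b, g x = Some b -> \sum_i \sum_m a x i m ^+ 2 <= d) /\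
    (forall x y, g x = Some true -> g y = Some false ->
       \sum_i \sum_m (x i != y i)%:R * (a x i m * a y i m) = 1).

Section Duality.
Variables (R : realType) (N : nat) (g : pfun N) (d : R).
Let F := bits N.
Let M := 'I_#|F|.+1.
Let I : finType := ('I_N * F * M)%type.
Implicit Types a : I -> R.

Definition dgram a (x y : F) : R :=
  \sum_i \sum_m (x i != y i)%:R * (a (i, x, m) * a (i, y, m)).
Definition dcost a (x : F) : R := \sum_i \sum_m a (i, x, m) ^+ 2.
Definition dpair (x y : F) : R := ((g x == Some true) && (g y == Some false))%:R.
Definition dexcess a (x : F) : R := Num.max (dcost a x - d) 0.
(** Total squared violation of the constraints; it vanishes only at dual solutions of cost [d].
    Penalising the cost also bounds the sublevel sets, which is what makes a minimiser exist. *)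
Definition dobj a : R :=
  \sum_x \sum_y dpair x y * (1 - dgram a x y) ^+ 2 + \sum_x dexcess a x ^+ 2.

Lemma continuous_dobj : continuous (fun v => dobj (@coords R I v)).
Proof.
have cx i := @continuous_coords R I i.
apply: continuous_add; apply: continuous_sum => x; last first.
  have c : continuous (fun v => dexcess (@coords R I v) x).
    apply: continuous_maxr; apply: continuous_add; last exact: continuous_cst.
    apply: continuous_sum => i; apply: continuous_sum => m.
    by apply: continuous_mul; exact: cx.
  by apply: continuous_mul; exact: c.
apply: continuous_sum => y; apply: continuous_mul; first exact: continuous_cst.
have c : continuous (fun v => 1 - dgram (@coords R I v) x y).
  apply: continuous_add; first exact: continuous_cst.
  apply: continuous_opp; apply: continuous_sum => i; apply: continuous_sum => m.
  apply: continuous_mul; first exact: continuous_cst.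
  by apply: continuous_mul; exact: cx.
by apply: continuous_mul; exact: c.
Qed.

Lemma dobj_min : exists a, forall b, dobj a <= dobj b.
Proof.
pose B := dobj (fun=> 0).
have [||||a [Aa amin]] := @attains_min R I dobj (fun a => dobj a <= B) (`|d| + B + 2).
- exact: continuous_dobj.
- have := @preimage_closed _ _ (fun v => dobj (@coords R I v)) [set x | x <= B]%classic.
  by apply=> [v _|]; [exact: continuous_dobj|exact: closed_le].
- by exists (fun=> 0).
- move=> a Aa [[i x] m].
  have B0 : 0 <= B.
    apply: addr_ge0; apply: sumr_ge0 => y _; last exact: sqr_ge0.
    by apply: sumr_ge0 => z _; rewrite mulr_ge0 ?ler0n // sqr_ge0.
  have e1 : dexcess a x ^+ 2 <= B.
    apply: le_trans Aa; rewrite /dobj [X in _ + X](bigD1 x) //= addrCA lerDl.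
    apply: addr_ge0; apply: sumr_ge0 => y _; last exact: sqr_ge0.
    by apply: sumr_ge0 => z _; rewrite mulr_ge0 ?ler0n // sqr_ge0.
  have e2 : dcost a x - d <= dexcess a x by rewrite /dexcess le_max lexx.
  have e3 : dexcess a x <= B + 1 by nra.
  have e4 : a (i, x, m) ^+ 2 <= dcost a x.
    rewrite /dcost (bigD1 i) //= (bigD1 m) //= -addrA lerDl.
    apply: addr_ge0; apply: sumr_ge0 => y _; first exact: sqr_ge0.
    by apply: sumr_ge0 => z _; exact: sqr_ge0.
  have e5 := ler_norm d.
  have e6 : `|a (i, x, m)| ^+ 2 <= `|d| + B + 1.
    by rewrite real_normK ?num_real //; lra.
  have e7 := normr_ge0 d; have e8 := normr_ge0 (a (i, x, m)).
  nra.
- exists a => b; case: (leP (dobj b) B) => [|/ltW h]; first exact: amin.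
  exact: le_trans Aa h.
Qed.

Variable a : I -> R.
Hypothesis amin : forall b, dobj a <= dobj b.
Let r x y := 1 - dgram a x y.
Let p x := dexcess a x.

(** First-order optimality along curves on which Gram values and costs move linearly in [s]. The
    vectors may move like the square root of [s]: the problem is convex in the Gram matrices, not in
    the vectors. *)
Lemma kkt (P : F -> F -> R) (Q : F -> R) :
  (forall s, 0 < s -> s < 1 -> exists b,
     (forall x y, dgram b x y = dgram a x y + s * P x y) /\
     (forall x, dcost b x = dcost a x + s * Q x)) ->
  \sum_x \sum_y dpair x y * r x y * P x y <= \sum_x p x * Q x.
Proof.
move=> h; rewrite -subr_ge0; set D := _ - _.
suff : 0 <= 2 * D by rewrite pmulr_rge0 ?ltr0n.
apply: (@first_order_ge0 R _ (\sum_x \sum_y dpair x y * P x y ^+ 2 + \sum_x Q x ^+ 2)).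
move=> s s0 s1; have [b [hP hQ]] := h s s0 s1.
(* The excess is a positive part, so after the move its square is bounded by that of
   [p x + s * Q x], with a loss only where the positive part truncates. *)
have le_b : dobj b <= \sum_x \sum_y dpair x y * (r x y - s * P x y) ^+ 2
                     + \sum_x (p x + s * Q x) ^+ 2.
  apply: lerD.
    apply: ler_sum => x _; apply: ler_sum => y _; rewrite hP /r opprD addrA //.
  apply: ler_sum => x _; rewrite /p /dexcess hQ.
  rewrite /Num.max; case: ifP; case: ifP; nra.
have := le_trans (amin b) le_b; rewrite -subr_ge0.
suff -> : \sum_x \sum_y dpair x y * (r x y - s * P x y) ^+ 2
    + \sum_x (p x + s * Q x) ^+ 2 - dobj a =
  s * (2 * D) + s ^+ 2 * (\sum_x \sum_y dpair x y * P x y ^+ 2 + \sum_x Q x ^+ 2) by [].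
have e1 : \sum_x \sum_y dpair x y * (r x y - s * P x y) ^+ 2 =
   \sum_x \sum_y dpair x y * r x y ^+ 2
   - 2 * s * (\sum_x \sum_y dpair x y * r x y * P x y)
   + s ^+ 2 * (\sum_x \sum_y dpair x y * P x y ^+ 2).
  rewrite !mulr_sumr -sumrB -big_split; apply: eq_bigr => x _ /=.
  rewrite !mulr_sumr -sumrB -big_split; apply: eq_bigr => y _ /=; ring.
have e2 : \sum_x (p x + s * Q x) ^+ 2 =
   \sum_x p x ^+ 2 + 2 * s * (\sum_x p x * Q x) + s ^+ 2 * (\sum_x Q x ^+ 2).
  rewrite !mulr_sumr -!big_split; apply: eq_bigr => x _ /=; ring.
rewrite e1 e2 /dobj /D -/r -/p; ring.
Qed.

(** Optimality under shrinking all vectors by the square root of 1 - s. *)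
Lemma kkt_scale :
  \sum_x p x * dcost a x <= \sum_x \sum_y dpair x y * r x y * dgram a x y.
Proof.
suff : \sum_x \sum_y dpair x y * r x y * - dgram a x y <= \sum_x p x * - dcost a x.
  have -> : \sum_x p x * - dcost a x = - \sum_x p x * dcost a x.
    by rewrite -sumrN; apply: eq_bigr => x _; rewrite mulrN.
  have -> : \sum_x \sum_y dpair x y * r x y * - dgram a x y =
      - \sum_x \sum_y dpair x y * r x y * dgram a x y.
    rewrite -sumrN; apply: eq_bigr => x _; rewrite -sumrN; apply: eq_bigr => y _.
    by rewrite mulrN.
  by rewrite lerN2.
apply: (@kkt (fun x y => - dgram a x y) (fun x => - dcost a x)).
move=> s s0 s1; 
have [t sq] : exists t, t * t = 1 - s.
  by exists (Num.sqrt (1 - s)); rewrite -expr2 sqr_sqrtr //; lra.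
exists (fun i => t * a i).
split=> [x y|x].
  transitivity ((1 - s) * dgram a x y); last by ring.
  rewrite -sq mulr_sumr; apply: eq_bigr => i _; rewrite mulr_sumr; apply: eq_bigr => m _.
  ring.
transitivity ((1 - s) * dcost a x); last by ring.
rewrite -sq mulr_sumr; apply: eq_bigr => i _; rewrite mulr_sumr; apply: eq_bigr => m _.
ring.
Qed.

(* the #|F| rows [a (i, x, _)] leave room for a unit vector orthogonal to all of them *)
Lemma free_direction i : exists q : M -> R,
  \sum_m q m ^+ 2 = 1 /\ forall x, \sum_m q m * a (i, x, m) = 0.
Proof.
pose A := \matrix_(m < #|F|.+1, j < #|F|) a (i, enum_val j, m).
have : kermx A != 0.
  rewrite -mxrank_eq0 mxrank_ker -lt0n subn_gt0.
  exact: leq_ltn_trans (rank_leq_col A) _.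
case/rowV0Pn => v /sub_kermxP vA v0.
have n0 : 0 < \sum_m v ord0 m ^+ 2.
  rewrite lt0r sumr_ge0 => [|m _]; last exact: sqr_ge0.
  rewrite andbT; apply: contra v0; rewrite psumr_eq0 => [|m _]; last exact: sqr_ge0.
  move/allP => h; apply/eqP/rowP => m; rewrite mxE; apply/eqP.
  by have := h m (mem_index_enum m); rewrite /= sqrf_eq0.
exists (fun m => v ord0 m / Num.sqrt (\sum_m v ord0 m ^+ 2)); split.
  under eq_bigr do rewrite exprMn exprVn sqr_sqrtr ?ltW //.
  by rewrite -mulr_suml divff // gt_eqF.
move=> x; have /rowP/(_ (enum_rank x)) := vA; rewrite !mxE => e.
transitivity ((\sum_m v ord0 m * A m (enum_rank x)) / Num.sqrt (\sum_m v ord0 m ^+ 2)).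
  rewrite mulr_suml; apply: eq_bigr => m _; rewrite mxE enum_rankK; ring.
by rewrite e mul0r.
Qed.

(** Adding sqrt(s) w(x) q to the vectors at index [i], with [q] orthogonal to all of them, kills the
    cross terms and changes the Gram matrix by exactly s w(x) w(y). This becomes the spectral bound
    on the masked adversary matrix. *)
Lemma kkt_rank_one i (w : F -> R) :
  \sum_x \sum_y dpair x y * r x y * ((x i != y i)%:R * (w x * w y))
  <= \sum_x p x * w x ^+ 2.
Proof.
apply: (@kkt (fun x y : F => (x i != y i)%:R * (w x * w y)) (fun x => w x ^+ 2)) => s s0 s1.
have [q [q1 q0]] := free_direction i.
have [t sq] : exists t, t * t = s.
  by exists (Num.sqrt s); rewrite -expr2 sqr_sqrtr // ltW.
exists (fun j => a j + (j.1.1 == i)%:R * (t * (w j.1.2 * q j.2))).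
have E x y : \sum_m (a (i, x, m) + t * (w x * q m)) *
     (a (i, y, m) + t * (w y * q m)) =
  \sum_m (a (i, x, m) * a (i, y, m)) + s * (w x * w y).
  transitivity (\sum_m (a (i, x, m) * a (i, y, m)) + t * w y * (\sum_m q m * a (i, x, m))
    + t * w x * (\sum_m q m * a (i, y, m)) + s * (w x * w y) * \sum_m q m ^+ 2).
    rewrite !mulr_sumr -!big_split; apply: eq_bigr => m _ /=.
    by rewrite -sq; ring.
  by rewrite !q0 q1 !mulr0 mulr1 !addr0.
split=> [x y|x].
  rewrite /dgram (bigD1 i) //= [in RHS](bigD1 i) //= [RHS]addrAC; congr (_ + _); last first.
    apply: eq_bigr => j /negbTE ji; apply: eq_bigr => m _ /=.
    by rewrite ji !mul0r !addr0.
  under eq_bigr do rewrite eqxx !mul1r.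
  rewrite -!mulr_sumr E; ring.
rewrite /dcost (bigD1 i) //= [in RHS](bigD1 i) //= [RHS]addrAC; congr (_ + _); last first.
  apply: eq_bigr => j /negbTE ji; apply: eq_bigr => m _ /=.
  by rewrite ji !mul0r !addr0.
under eq_bigr do rewrite eqxx mul1r expr2.
by rewrite E expr2.
Qed.

Lemma p_ge0 x : 0 <= p x.
Proof. by rewrite /p /dexcess le_max lexx orbT. Qed.

Lemma kkt_gap : dobj a + d * \sum_x p x <= \sum_x \sum_y dpair x y * r x y.
Proof.
have h := kkt_scale.
have e1 : \sum_x \sum_y dpair x y * r x y = \sum_x \sum_y dpair x y * r x y ^+ 2 +
   \sum_x \sum_y dpair x y * r x y * dgram a x y.
  rewrite -big_split; apply: eq_bigr => x _ /=; rewrite -big_split; apply: eq_bigr => y _ /=.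
  by rewrite /r; ring.
have e2 : \sum_x p x * dcost a x = \sum_x p x ^+ 2 + d * \sum_x p x.
  rewrite mulr_sumr -big_split; apply: eq_bigr => x _ /=.
  rewrite /p /dexcess /Num.max; case: ifP => _; ring.
rewrite e1 /dobj -addrA lerD2l; rewrite e2 in h; exact: h.
Qed.

(** Makes the division by the square roots of [p] in the adversary matrix harmless. Rank-one
    optimality for [w] supported on x and y reads c s t <= p(x) s^2 + p(y) t^2, which fails for
    suitable s, t if one coefficient on the right is zero. *)
Lemma residual_support x y : dpair x y * r x y != 0 -> p x != 0 /\ p y != 0.
Proof.
move=> nz.
have : dpair x y != 0 by apply: contra_neq nz => ->; rewrite mul0r.
rewrite /dpair pnatr_eq0 eqb0 negbK => /andP [/eqP gx /eqP gy].
have xy : x != y by apply/eqP => e; move: gx; rewrite e gy.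
have [i xi] : exists i, x i != y i.
  by apply/existsP; apply: contraNT xy; rewrite negb_exists => /forallP e;
     apply/eqP/ffunP => i; apply/eqP; rewrite -[_ == _]negbK; exact: e.
set c := dpair x y * r x y in nz *.
have key (s t : R) : c * (s * t) <= p x * s ^+ 2 + p y * t ^+ 2.
  pose w z := if z == x then s else if z == y then t else 0.
  have wx : w x = s by rewrite /w eqxx.
  have wy : w y = t by rewrite /w eqxx eq_sym (negbTE xy).
  have w0 z : z != x -> z != y -> w z = 0 by rewrite /w => /negbTE -> /negbTE ->.
  have := kkt_rank_one i w.
  have -> : \sum_x p x * w x ^+ 2 = p x * s ^+ 2 + p y * t ^+ 2.
    rewrite (bigD1 x) //= (bigD1 y) ?(eq_sym y) //= wx wy big1 ?addr0 // => z /andP [zx zy].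
    by rewrite w0 // expr0n mulr0.
  suff -> : \sum_x \sum_y dpair x y * r x y * ((x i != y i)%:R * (w x * w y)) = c * (s * t) by [].
  have z1 u v : w u = 0 -> dpair u v * r u v * ((u i != v i)%:R * (w u * w v)) = 0.
    by move=> ->; rewrite mul0r !mulr0.
  have z2 u v : w v = 0 -> dpair u v * r u v * ((u i != v i)%:R * (w u * w v)) = 0.
    by move=> ->; rewrite !mulr0.
  have z3 v : dpair y v = 0 by rewrite /dpair gy.
  have z4 u : dpair u x = 0 by rewrite /dpair gx andbF.
  rewrite (bigD1 x) //= [X in _ + X]big1 ?addr0 => [|u ux]; last first.
    rewrite big1 // => v _; have [->|uy] := eqVneq u y; first by rewrite z3 !mul0r.
    by rewrite z1 // w0.
  rewrite (bigD1 y) //= [X in _ + X]big1 ?addr0 => [|v vy]; last first.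
    have [->|vx] := eqVneq v x; first by rewrite z4 !mul0r.
    by rewrite z2 // w0.
  by rewrite xi mul1r wx wy.
have px := p_ge0 x; have py := p_ge0 y.
split; apply/eqP => e0.
  (* This choice turns the inequality into p(y) + 1 <= p(y). *)
  have := key ((p y + 1) / c) 1; rewrite e0 mulr1 mulrCA divff // mul0r expr1n; lra.
have := key 1 ((p x + 1) / c); rewrite e0 mul1r mulrCA divff // mul0r expr1n; lra.
Qed.

End Duality.

Lemma rform_max (R : realType) (F : finType) (K : F -> F -> R) :
  (exists w : F -> R, sumsq w = 1) ->
  exists del, sumsq del = 1 /\ forall w : F -> R, rform K w <= rform K del * sumsq w.
Proof.
move=> [w0 hw0].
have [||||del [del1 hmax]] := @attains_min R F (fun w => - rform K w) (fun w => sumsq w = 1) 1.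
- apply: continuous_opp; apply: continuous_sum => x; apply: continuous_sum => y.
  apply: continuous_mul; last exact: continuous_coords.
  apply: continuous_mul; first exact: continuous_coords.
  exact: continuous_cst.
- have c : continuous (fun v => sumsq (@coords R F v)).
    apply: continuous_sum => x.
    by apply: continuous_mul; exact: continuous_coords.
  have := @preimage_closed _ _ (fun v => sumsq (@coords R F v)) [set x | x = 1]%classic.
  by apply=> [v _|]; [exact: c|exact: closed_eq].
- by exists w0.
- move=> w w1 x.
  have : `|w x| ^+ 2 <= 1.
    rewrite real_normK ?num_real // -w1 /sumsq (bigD1 x) //= lerDl.
    by apply: sumr_ge0 => y _; exact: sqr_ge0.
  have := normr_ge0 (w x); nra.
exists del; split=> // w.
have [z|nz] := eqVneq (sumsq w) 0.
  have w_0 x : w x = 0.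
    move/eqP: z; rewrite psumr_eq0 => [/allP /(_ x (mem_index_enum x))/=|y _]; last exact: sqr_ge0.
    by rewrite sqrf_eq0 => /eqP.
  rewrite z mulr0 /rform big1 // => x _; rewrite big1 // => y _.
  by rewrite w_0 !mul0r.
have s0 : 0 < sumsq w by rewrite lt0r nz sumsq_ge0.
have [t [t0 tt]] : exists t, 0 < t /\ t * t = (sumsq w)^-1.
  exists (Num.sqrt (sumsq w)^-1); rewrite sqrtr_gt0 invr_gt0; split=> //.
  by rewrite -expr2 sqr_sqrtr // invr_ge0 ltW.
have := hmax (fun x => t * w x).
have -> : sumsq (fun x => t * w x) = 1.
  rewrite /sumsq; under eq_bigr do rewrite exprMn expr2 tt.
  by rewrite -mulr_sumr mulVf.
move/(_ erefl); rewrite lerN2.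
have -> : rform K (fun x => t * w x) = (sumsq w)^-1 * rform K w.
  rewrite -tt /rform mulr_sumr; apply: eq_bigr => x _; rewrite mulr_sumr.
  by apply: eq_bigr => y _; ring.
by rewrite mulrC ler_pdivrMr.
Qed.

Lemma infeasible_adversary (R : realType) N (g : pfun N) (d : R) :
  0 <= d -> ~ feasible g d ->
  exists Gam lam del, @adversary R N g Gam lam del /\ d < lam.
Proof.
move=> d0 infeas.
have [a amin] := dobj_min g d.
pose r x y := 1 - dgram a x y.
pose p x := dexcess d a x.
have p0 x : 0 <= p x by exact: p_ge0.
have obj0 : 0 < dobj g d a.
  rewrite lt0r; apply/andP; split; last first.
    apply: addr_ge0; apply: sumr_ge0 => y _; last exact: sqr_ge0.
    by apply: sumr_ge0 => z _; rewrite mulr_ge0 ?ler0n // sqr_ge0.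
  apply/eqP => e; apply: infeas.
  exists _, (fun x i m => a (i, x, m)).
  move/eqP: e; rewrite paddr_eq0; last 2 first.
  - by apply: sumr_ge0 => x _; apply: sumr_ge0 => y _; rewrite mulr_ge0 ?ler0n // sqr_ge0.
  - by apply: sumr_ge0 => x _; exact: sqr_ge0.
  case/andP; rewrite psumr_eq0; last first.
    by move=> x _; apply: sumr_ge0 => y _; rewrite mulr_ge0 ?ler0n // sqr_ge0.
  move=> /allP h1; rewrite psumr_eq0 => [/allP h2|x _]; last exact: sqr_ge0.
  split=> [x b _|x y gx gy].
    have := h2 x (mem_index_enum x); rewrite /= sqrf_eq0 => /eqP e.
    have : dcost a x - d <= dexcess d a x by rewrite le_max lexx.
    by rewrite e subr_le0.
  have := h1 x (mem_index_enum x); rewrite /= psumr_eq0; last first.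
    by move=> z _; rewrite mulr_ge0 ?ler0n // sqr_ge0.
  move=> /allP /(_ y (mem_index_enum y)) /=.
  rewrite /dpair gx gy !eqxx mul1r sqrf_eq0 subr_eq0 => /eqP h; exact: esym h.
pose e := dpair R g.
pose c x y := e x y * r x y.
have c_supp x y : c x y != 0 -> p x != 0 /\ p y != 0 by exact: residual_support.
have gap : d * \sum_x p x < \sum_x \sum_y c x y.
  have := kkt_gap amin; rewrite -/p -/r; apply: lt_le_trans; by rewrite ltrDr.
pose q x := Num.sqrt (p x).
have qq x : q x * q x = p x by rewrite -expr2 sqr_sqrtr.
have q_neq0 x : p x != 0 -> q x != 0 by apply: contra_neq => h; rewrite -qq h mul0r.
(* Residuals, symmetrised and normalised by the square roots of the excesses; the substitution w / q
   then turns [kkt_rank_one] into the bound required of the masked matrix. *)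
pose Gam x y := 2^-1 * (c x y + c y x) / (q x * q y).
have form_Gam (D : bits N -> bits N -> R) w : (forall x y, D x y = D y x) ->
    rform (fun x y => D x y * Gam x y) w
    = \sum_x \sum_y c x y * (D x y * ((w x / q x) * (w y / q y))).
  move=> DC; set rhs := RHS.
  have -> : rhs = 2^-1 * (rhs + rhs) by field.
  rewrite /rhs [X in _ = _ * (X + _)]exchange_big /= addrC -big_split mulr_sumr.
  apply: eq_bigr => x _ /=; rewrite -big_split mulr_sumr; apply: eq_bigr => y _ /=.
  by rewrite (DC y x) /Gam invfM; ring.
have sumsq_div w : \sum_x p x * (w x / q x) ^+ 2 <= sumsq w.
  apply: ler_sum => x _; have [->|nz] := eqVneq (p x) 0; first by rewrite mul0r sqr_ge0.
  by rewrite -qq -expr2 -exprMn mulrC divfK // q_neq0.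
have P0 : 0 < \sum_x p x.
  rewrite lt0r sumr_ge0 ?andbT //; apply: contraL gap => /eqP z.
  rewrite z mulr0 -leNgt big1 // => x _; rewrite big1 // => y _.
  apply/eqP; apply/negPn/negP => /c_supp [] /negP [].
  by move/eqP: z; rewrite psumr_eq0 // => /allP /(_ x (mem_index_enum x)).
have P_0 : \sum_x p x != 0 by rewrite gt_eqF.
have q_form : rform Gam q = \sum_x \sum_y c x y.
  transitivity (rform (fun x y => 1 * Gam x y) q).
    by apply: rform_ext => x y; rewrite mul1r.
  rewrite (form_Gam (fun _ _ => 1)) //; apply: eq_bigr => x _; apply: eq_bigr => y _.
  have [->|nz] := eqVneq (c x y) 0; first by rewrite mul0r.
  by have [px py] := c_supp x y nz; rewrite !divff ?q_neq0 // !mulr1.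
have q_sq : sumsq q = \sum_x p x by apply: eq_bigr => x _; rewrite expr2 qq.
have [del [del1 hmax]] : exists del, sumsq del = 1 /\
    forall w, rform Gam w <= rform Gam del * sumsq w.
  apply: rform_max; exists (fun x => q x / Num.sqrt (\sum_x p x)).
  have e2 : Num.sqrt (\sum_x p x) ^+ 2 = \sum_x p x by rewrite sqr_sqrtr // ltW.
  rewrite /sumsq; under eq_bigr do rewrite exprMn exprVn e2.
  by rewrite -mulr_suml -/(sumsq q) q_sq divff.
(* The test vector [q] has form equal to the sum of the residuals and squared norm equal to the sum
   of the excesses, so [gap] puts the top eigenvalue above [d]. *)
have dlam : d < rform Gam del.
  have := hmax q; rewrite q_form q_sq => h; have := lt_le_trans gap h.
  by rewrite ltr_pM2r.
exists Gam, (rform Gam del), del; split=> //.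
have GamC x y : Gam x y = Gam y x by rewrite /Gam addrC (mulrC (q x)).
split=> //.
- by split=> //; exact: le_lt_trans dlam.
- move=> x y nz.
  have : (c x y != 0) || (c y x != 0).
    rewrite -negb_and; apply: contra nz => /andP [/eqP z1 /eqP z2].
    by rewrite /Gam z1 z2 addr0 mulr0 mul0r.
  have h u v : c u v != 0 -> g u = Some true /\ g v = Some false.
    have [z|nz'] := eqVneq (e u v) 0; first by rewrite /c z mul0r eqxx.
    by move: nz'; rewrite /e /dpair pnatr_eq0 eqb0 negbK => /andP [/eqP -> /eqP ->].
  by case/orP => /h [h1 h2]; [exists true|exists false].
- move=> i w; apply: le_trans (sumsq_div w).
  rewrite (form_Gam (fun x y => (x i != y i)%:R)); last by move=> x y; rewrite eq_sym.
  exact: (kkt_rank_one amin).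
Qed.

(** * Reflections and phase oracles *)

Section Reflections.
Variables (R : realType) (S : finType).
Local Notation C := R[i].

Definition hermitian_op (A : op R S) : Prop := forall s t, A t s = (A s t)^*.

Lemma hermitian_ip A (u v : S -> C) : hermitian_op A ->
  ip u (mapply A v) = ip (mapply A u) v.
Proof.
move=> hA; rewrite /ip /mapply.
under eq_bigr do rewrite mulr_sumr.
rewrite exchange_big; apply: eq_bigr => t _ /=.
rewrite rmorph_sum mulr_suml; apply: eq_bigr => s _.
by rewrite rmorphM /= (hA t s); ring.
Qed.

(** Gram-Schmidt one vector at a time; a vector already in the span leaves the projector
    unchanged. *)
Lemma projector_exists (v : nat -> S -> C) n : exists L : op R S,
  [/\ hermitian_op L, (forall u, mapply L (mapply L u) = mapply L u),
      (forall i, (i < n)%N -> mapply L (v i) = v i)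
    & (forall u, (forall i, (i < n)%N -> ip (v i) u = 0) -> mapply L u = fun=> 0)].
Proof.
elim: n => [|n [L [hL LL Lv Lu]]].
  exists (fun _ _ => 0); split=> // [s t|u|u _]; first by rewrite rmorph0.
    by apply/funext => s; rewrite /mapply !big1 // => t _; rewrite mul0r.
  by apply/funext => s; rewrite /mapply big1 // => t _; rewrite mul0r.
pose w s := v n s - mapply L (v n) s.
have Lw : mapply L w = fun=> 0.
  by rewrite /w mapplyB LL; apply/funext => s; rewrite subrr.
have ipLw u : ip w (mapply L u) = 0.
  by rewrite hermitian_ip // Lw /ip big1 // => s _; rewrite rmorph0 mul0r.
have orth_w u : (forall i, (i < n.+1)%N -> ip (v i) u = 0) -> ip w u = 0.
  move=> h; rewrite /w ipBl h // sub0r -hermitian_ip // Lu.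
    by rewrite /ip big1 ?oppr0 // => s _; rewrite mulr0.
  by move=> i lin; apply: h; exact: ltnW.
have [z|nz] := eqVneq (sqn w) 0.
  exists L; split=> // [i|u h].
    rewrite ltnS leq_eqVlt => /orP [/eqP ->|]; last exact: Lv.
    apply/funext => s; have := sqn_eq0 z s; rewrite /w => /eqP.
    by rewrite subr_eq0 => /eqP <-.
  by apply: Lu => i lin; apply: h; exact: ltnW.
have cw : (sqn w)^* = sqn w by apply/conj_Creal; rewrite ger0_real // sqn_ge0.
pose L' s t := L s t + (sqn w)^-1 * (w s * (w t)^*).
have L'E u : mapply L' u = fun s => mapply L u s + (sqn w)^-1 * ip w u * w s.
  apply/funext => s; rewrite /mapply /L' /ip.
  under eq_bigr do rewrite mulrDl; rewrite big_split /=; congr (_ + _).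
  rewrite mulr_sumr mulr_suml; apply: eq_bigr => t _; ring.
have w_w : ip w w = sqn w by rewrite sqnE.
exists L'; split.
- move=> s t; rewrite /L' [RHS]rmorphD /= -hL; congr (_ + _).
  rewrite [RHS]rmorphM /= fmorphV /= cw; congr (_ * _).
  rewrite [RHS]rmorphM /= conjCK; exact: mulrC.
- move=> u; rewrite !L'E mapplyD LL mapplyZ Lw.
  apply/funext => s; rewrite mulr0 addr0; congr (_ + _).
  rewrite ipDr ipZr ipLw add0r w_w; field; exact: nz.
- move=> i; rewrite ltnS leq_eqVlt => /orP [/eqP ->|lin]; rewrite L'E.
    have -> : ip w (v n) = sqn w.
      have -> : v n = fun s => w s + mapply L (v n) s.
        by apply/funext => s; rewrite /w subrK.
      by rewrite ipDr ipLw addr0.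
    apply/funext => s; rewrite mulVf // mul1r /w addrC subrK //.
  apply/funext => s; rewrite Lv //.
  have -> : ip w (v i) = 0 by rewrite -(Lv i lin) ipLw.
  by rewrite mulr0 mul0r addr0.
- move=> u h; rewrite L'E orth_w // Lu; last by move=> i lin; apply: h; exact: ltnW.
  by apply/funext => s; rewrite mulr0 mul0r addr0.
Qed.

Lemma reflection_exists (v : nat -> S -> C) n : exists A : op R S,
  [/\ hermitian_op A, unitary A, (forall i, (i < n)%N -> mapply A (v i) = v i)
    & (forall u, (forall i, (i < n)%N -> ip (v i) u = 0) -> mapply A u = fun s => - u s)].
Proof.
have [L [hL LL Lv Lu]] := projector_exists v n.
pose A s t := 2 * L s t - (s == t)%:R.
have AE u : mapply A u = fun s => 2 * mapply L u s - u s.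
  apply/funext => s; rewrite /mapply /A.
  under eq_bigr do rewrite mulrBl; rewrite sumrB; congr (_ - _).
    by rewrite mulr_sumr; apply: eq_bigr => t _; rewrite mulrA.
  by rewrite (bigD1 s) //= eqxx mul1r big1 ?addr0 // => t; rewrite eq_sym => /negbTE ->; rewrite mul0r.
exists A; split.
- move=> s t; rewrite /A rmorphB rmorphM /= hL eq_sym !rmorph_nat; congr (_ * _ - _).
- apply: isometry_unitary => u w; rewrite !AE ipBl !ipBr !ipZl !ipZr conjC_nat.
  by rewrite -!(hermitian_ip u) // LL; ring.
- by move=> i lin; rewrite AE Lv //; apply/funext => s; ring.
- by move=> u /Lu h; rewrite AE h; apply/funext => s; ring.
Qed.

End Reflections.

Section PhaseOracle.
Variables (R : realType) (N : nat) (W : finType).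
Local Notation C := R[i].
Local Notation S := (Sp N W).

(** The oracle conjugated by a Hadamard gate on the answer bit, which thereby becomes a control of
    the phase. *)
Definition phase (x : bits N) (v : S -> C) : S -> C :=
  fun s => (-1) ^+ (s.1.2 && x s.1.1) * v s.

Fixpoint phase_run (V : nat -> op R S) (init : S) (x : bits N) (t : nat) : S -> C :=
  match t with
  | 0 => mapply (V 0%N) (basis_vec R init)
  | t'.+1 => mapply (V t) (phase x (phase_run V init x t'))
  end.

Lemma sqn_phase x v : sqn (phase x v) = sqn v.
Proof.
by apply: eq_bigr => s _; rewrite /phase normrM normrX normrN1 expr1n mul1r.
Qed.

Lemma sqn_phase_run V init x T : (forall t, (t <= T)%N -> unitary (V t)) ->
  forall t, (t <= T)%N -> sqn (phase_run V init x t) = 1.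
Proof.
move=> hV; elim=> [|t IH] tT /=; (rewrite unitary_sqn; last exact: hV).
  exact: sqn_basis.
by rewrite sqn_phase IH // ltnW.
Qed.

Let c : C := (Num.sqrt 2)^-1%:C%C.

Let cc : c * c = 2^-1.
Proof.
rewrite /c -rmorphM /= -expr2 exprVn sqr_sqrtr ?ler0n //.
by rewrite fmorphV rmorph_nat.
Qed.

Let c_conj : c^* = c. Proof. exact: conj_real. Qed.

Definition hadamard : op R S := fun s s' =>
  ((s.1.1 == s'.1.1) && (s.2 == s'.2))%:R * (c * (-1) ^+ (s.1.2 && s'.1.2)).

Lemma mapply_hadamard v s : mapply hadamard v s =
  c * (v ((s.1.1, false), s.2) + (-1) ^+ s.1.2 * v ((s.1.1, true), s.2)).
Proof.
rewrite /mapply sum_Sp (bigD1 (s.1.1, s.2)) //= /hadamard /= !eqxx /=.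
rewrite big1 => [|[i w] /=].
  by rewrite andbF andbT expr0 addr0; ring.
rewrite xpair_eqE eq_sym [w == _]eq_sym => /negbTE -> /=; ring.
Qed.

Lemma hadamard_ip u v : ip (mapply hadamard u) (mapply hadamard v) = ip u v.
Proof.
rewrite /ip !sum_Sp; apply: eq_bigr => -[i w] _; rewrite !mapply_hadamard /=.
rewrite expr0 expr1 !rmorphM !rmorphD !rmorphM rmorphN rmorph1 /= c_conj.
set a := u _; set b := u _; set a' := v _; set b' := v _.
transitivity ((c * c) * (2 * (a^* * a' + b^* * b'))); first by ring.
by rewrite cc; field.
Qed.

Lemma unitary_hadamard : unitary hadamard.
Proof. by apply: isometry_unitary => u v; exact: hadamard_ip. Qed.

Lemma hadamardK v : mapply hadamard (mapply hadamard v) = v.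
Proof.
apply/funext => -[[i b] w]; rewrite !mapply_hadamard /=.
set a := v _; set a' := v _.
transitivity ((c * c) * (2 * (if b then a' else a))); first by case: b; ring.
by rewrite cc mulrA mulVf ?mul1r ?pnatr_eq0 //; case: b.
Qed.

Lemma hadamard_oracle x v :
  mapply (@oracle R N W x) (mapply hadamard v) = mapply hadamard (phase x v).
Proof.
apply/funext => -[[i b] w]; rewrite mapply_oracle !mapply_hadamard /phase /=.
by case: b; case: (x i) => /=; ring.
Qed.

Lemma phase_computes (g : pfun N) T (V : nat -> op R S) (init : S) (out : W -> bool) :
  (forall t, (t <= T)%N -> unitary (V t)) ->
  (forall x b, g x = Some b ->
     2 / 3 <= \sum_(s | out s.2 == b) `|phase_run V init x T s| ^+ 2) ->
  computes R g T.
Proof.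
move=> hV hout.
pose U t := comp_op hadamard (if t is 0 then V t else comp_op (V t) hadamard).
have runE x t : run U init x t = mapply hadamard (phase_run V init x t).
  elim: t => [|t IH] /=; first by rewrite mapply_comp.
  by rewrite !mapply_comp IH hadamard_oracle hadamardK.
exists W, U, init, (fun s => out s.2); split.
  move=> [|t] tT; apply: unitary_comp; try exact: unitary_hadamard; first exact: hV.
  by apply: unitary_comp; [exact: hV|exact: unitary_hadamard].
move=> x b gx; apply: le_trans (hout x b gx) _; rewrite runE.
set v := phase_run _ _ _ _.
rewrite big_mkcond [leRHS]big_mkcond /= !sum_Sp le_eqVlt; apply/orP; left; apply/eqP.
apply: eq_bigr => -[i w] _ /=; rewrite !mapply_hadamard /=.
case: ifP => _ //; rewrite expr0 expr1 !normCK !rmorphM !rmorphD !rmorphM rmorphN rmorph1 /= c_conj.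
set a := v _; set a' := v _.
transitivity ((c * c) * (2 * (a * a^* + a' * a'^*))); last by ring.
by rewrite cc; field.
Qed.

End PhaseOracle.

(** * An algorithm from a dual solution *)

Section OrbitAverage.
Variables (R : realType) (S : finType) (U : op R S) (T : nat).
Local Notation C := R[i].
Hypothesis unitU : unitary U.
Hypothesis T_gt0 : (0 < T)%N.
Variable e0 : S -> C.

(** Ergodic average, an approximate projection of [e0] on the fixed space of [U]; it takes the place
    of phase estimation. *)
Definition orbit_avg : S -> C :=
  fun s => \sum_(t < T) T%:R^-1 * iter t (mapply U) e0 s.

Let T0 : (T%:R : C) != 0. Proof. by rewrite pnatr_eq0 -lt0n. Qed.

(** Every iterate, hence the average, keeps inner product 1 with the fixed vector [phi]. Expanding
    |avg - (2/3) phi|^2 >= 0 gives |avg|^2 >= 4/3 - (4/9)(3/2) = 2/3. *)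
Lemma orbit_avg_fixed phi : ip phi e0 = 1 -> mapply U phi = phi ->
  sqn phi <= 3 / 2 -> 2 / 3 <= sqn orbit_avg.
Proof.
move=> phi_e0 Uphi phi_le.
have it t : ip phi (iter t (mapply U) e0) = 1.
  by elim: t => [//|t IH] /=; rewrite -{1}Uphi unitary_ip.
have ip1 : ip phi orbit_avg = 1.
  rewrite ip_sumr; under eq_bigr do rewrite it mulr1.
  by rewrite sumr_const card_ord -[LHS]mulr_natr mulVf.
have ip1' : ip orbit_avg phi = 1 by rewrite ipC ip1 rmorph1.
have := sqn_ge0 (fun s => orbit_avg s - 2 / 3 * phi s).
rewrite sqnE ipBl !ipBr !ipZl !ipZr ip1 ip1' -!sqnE rmorphM fmorphV /= !conjC_nat => h.
have h2 : 2 / 3 * (2 / 3 * sqn phi) <= 2 / 3 * (2 / 3 * (3 / 2)).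
  by do 2 (apply: ler_wpM2l; first by rewrite divr_ge0).
have e1 : (2 / 3 * (2 / 3 * (3 / 2)) : C) = 2 / 3.
  by field; rewrite ?pnatr_eq0.
rewrite e1 in h2.
rewrite -subr_ge0; apply: le_trans h _.
rewrite -subr_ge0 [X in 0 <= X](_ : _ = 2 / 3 - 2 / 3 * (2 / 3 * sqn phi)); first by rewrite subr_ge0.
by ring.
Qed.

(** Here [e0] is a coboundary, so the average telescopes to (v - U^T v) / (2 T). *)
Lemma orbit_avg_boundary v B : (forall s, v s - mapply U v s = 2 * e0 s) ->
  sqn v <= B -> sqn orbit_avg <= B / T%:R ^+ 2.
Proof.
move=> hv vB.
have iterE t : iter t (mapply U) e0 =
    fun s => 2^-1 * (iter t (mapply U) v s - iter t.+1 (mapply U) v s).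
  elim: t => [|t IH] /=; last by rewrite IH mapplyZ mapplyB.
  by apply/funext => s /=; rewrite hv mulrA mulVf ?mul1r // pnatr_eq0.
have avgE : orbit_avg = fun s => (2 * T%:R)^-1 * (v s - iter T (mapply U) v s).
  apply/funext => s; rewrite /orbit_avg.
  have tele n : \sum_(t < n) T%:R^-1 * iter t (mapply U) e0 s =
      (2 * T%:R)^-1 * (v s - iter n (mapply U) v s).
    elim: n => [|n IH]; first by rewrite big_ord0 subrr mulr0.
    by rewrite big_ord_recr /= IH iterE /= invfM; ring.
  exact: tele.
have sq_it t : sqn (iter t (mapply U) v) = sqn v.
  by elim: t => [//|t IH] /=; rewrite unitary_sqn.
rewrite avgE sqnZ normfV exprVn mulrC ler_pdivrMr; last first.
  by rewrite exprn_gt0 // normr_gt0 mulf_neq0 // pnatr_eq0.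
apply: le_trans (sqnB2 _ _) _; rewrite sq_it normrM !normr_nat.
rewrite [leRHS](_ : _ = 4 * B); last by field.
rewrite -mulr2n -(mulr_natl (sqn v)) mulrA -natrM; exact: ler_wpM2l.
Qed.

End OrbitAverage.

Lemma sum_option (V : nmodType) (J : finType) (F : option J -> V) :
  \sum_o F o = F None + \sum_j F (Some j).
Proof.
rewrite (bigD1 None) //=; congr (_ + _).
rewrite (reindex_omap Some id) /=; last by case.
by apply: eq_bigl => m; rewrite eqxx.
Qed.

Lemma sum_pointed (V : nmodType) (J : finType) (j0 : J) (F : J -> V) :
  (forall j, j != j0 -> F j = 0) -> \sum_j F j = F j0.
Proof. by move=> h; rewrite (bigD1 j0) //= big1 ?addr0. Qed.

Section WitnessVectors.
Variables (R : realType) (N : nat) (M : finType) (i0 : 'I_N).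
Local Notation C := R[i].
Local Notation H := (Sp N (bool * option M)%type).

Definition origin : H := ((i0, false), (false, None)).

(** Span program witness. The work bit records the value of [z] at the query index, so two such
    vectors overlap, besides the origin, only at positions where their strings agree. *)
Definition wvec (f : 'I_N -> M -> R) (z : bits N) (h : H) : C :=
  (h == origin)%:R +
  (if h.1.2 && (h.2.1 == z h.1.1)
   then (if h.2.2 is Some m then (f h.1.1 m)%:C%C else 0) else 0).

Lemma ip_wvec f f' z z' :
  ip (wvec f z) (wvec f' z') =
  (1 + \sum_i \sum_m (z i == z' i)%:R * (f i m * f' i m))%:C%C.
Proof.
pose p (f : 'I_N -> M -> R) (z : bits N) (h : H) : C :=
  if h.1.2 && (h.2.1 == z h.1.1)
  then (if h.2.2 is Some m then (f h.1.1 m)%:C%C else 0) else 0.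
transitivity (\sum_(h : H) (((h == origin)%:R : C) + (p f z h)^* * p f' z' h)).
  apply: eq_bigr => h _; rewrite /wvec -/(p f z h) -/(p f' z' h).
  case: (eqVneq h origin) => [->|_]; last by rewrite /= !add0r.
  by rewrite /p /= !addr0 rmorph0 rmorph1 mul0r addr0 mulr1.
rewrite big_split /= rmorphD /=; congr (_ + _).
  by rewrite (bigD1 origin) //= eqxx big1 ?addr0 // => h /negbTE ->.
transitivity (\sum_(q : 'I_N * bool) \sum_(w : bool * option M)
   ((p f z (q, w))^* * p f' z' (q, w))).
  by rewrite [RHS]pair_bigA; apply: eq_bigr => -[].
transitivity (\sum_(i < N) \sum_(b : bool) \sum_(w : bool * option M)
   ((p f z ((i, b), w))^* * p f' z' ((i, b), w))).
  by rewrite [RHS]pair_bigA; apply: eq_bigr => -[].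
rewrite rmorph_sum; apply: eq_bigr => i _.
rewrite big_bool /= [X in _ + X]big1 ?addr0; last first.
  by move=> w _; rewrite /p /= mulr0.
transitivity (\sum_(c : bool) \sum_(o : option M)
   ((p f z ((i, true), (c, o)))^* * p f' z' ((i, true), (c, o)))).
  by rewrite [RHS]pair_bigA; apply: eq_bigr => -[].
rewrite (bigD1 (z i)) //= [X in _ + X]big1 ?addr0; last first.
  by move=> c /negbTE cz; rewrite big1 // => o _; rewrite /p /= cz rmorph0 mul0r.
rewrite sum_option /p /= eqxx rmorph0 mul0r add0r rmorph_sum.
apply: eq_bigr => m _ /=; rewrite conj_real.
by case: eqP => _; rewrite ?mul1r ?mul0r ?mulr0 ?rmorph0 // rmorphM.
Qed.

Lemma wvec_origin f z : ip (wvec f z) (basis_vec R origin) = 1.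
Proof. by rewrite ipC ip_basisl /wvec eqxx /= addr0 rmorph1. Qed.

Definition wsign (x : bits N) (h : H) : C := (-1) ^+ (h.1.2 && (h.2.1 (+) x h.1.1)).

Lemma wsign_wvec f x h : wsign x h * wvec f x h = wvec f x h.
Proof.
rewrite /wsign /wvec; case: eqP => [->|_] /=; first by rewrite expr0 mul1r.
rewrite add0r; case: h => -[i b] [c o] /=; case: b => /=; last by rewrite mulr0.
by case: eqP => [->|_]; rewrite ?addbb ?mul1r ?mulr0.
Qed.

(** For the complemented string the recorded bit is wrong everywhere, so all but the origin changes
    sign. *)
Lemma wsign_wvecN f x h : wsign x h * wvec f [ffun i => ~~ x i] h =
  2 * basis_vec R origin h - wvec f [ffun i => ~~ x i] h.
Proof.
rewrite /wsign /wvec /basis_vec; case: eqP => [->|_] /=; first by rewrite expr0 addr0; ring.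
rewrite !add0r mulr0 sub0r; case: h => -[i b] [c o] /=; case: b => /=; last by rewrite mulr0 oppr0.
rewrite ffunE; case: eqP => [->|_]; last by rewrite mulr0 oppr0.
by case: (x i) => /=; rewrite expr1 mulN1r.
Qed.

Lemma wsign_sq x h : wsign x h * wsign x h = 1.
Proof. by rewrite /wsign -exprD -signr_odd oddD addbb. Qed.

End WitnessVectors.

(** * A clock register controlling the number of iterations *)

Section Clock.
Variables (R : realType) (N : nat) (W J : finType).
Local Notation C := R[i].
Local Notation H := (Sp N W).
Local Notation S := (Sp N (W * J)%type).

Definition join (h : H) (t : J) : S := (h.1, (h.2, t)).
Definition hpart (s : S) : H := (s.1, s.2.1).

Lemma sum_join (F : S -> C) : \sum_s F s = \sum_h \sum_t F (join h t).
Proof.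
rewrite pair_big /= (reindex (fun q : H * J => join q.1 q.2)) //=.
by exists (fun s => (hpart s, s.2.2)) => [[[? ?] ?]|[? [? ?]]].
Qed.

Definition controlled (A : J -> op R H) : op R S :=
  fun s s' => (s.2.2 == s'.2.2)%:R * A s.2.2 (hpart s) (hpart s').

Definition on_clock (B : op R J) : op R S :=
  fun s s' => (hpart s == hpart s')%:R * B s.2.2 s'.2.2.

Lemma mapply_controlled A v h t :
  mapply (controlled A) v (join h t) = mapply (A t) (fun h' => v (join h' t)) h.
Proof.
rewrite /mapply sum_join; apply: eq_bigr => h' _; rewrite (bigD1 t) //=.
rewrite /controlled /= eqxx mul1r big1 ?addr0 => [|t' /negbTE tt].
  by case: h => ? ?; case: h' => ? ?.
by rewrite eq_sym tt !mul0r.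
Qed.

Lemma mapply_on_clock B v h t :
  mapply (on_clock B) v (join h t) = mapply B (fun t' => v (join h t')) t.
Proof.
have hj (h0 : H) t0 : hpart (join h0 t0) = h0 by case: h0.
rewrite /mapply sum_join (bigD1 h) //= [X in _ + X]big1 ?addr0 => [|h' /negbTE hh].
  by apply: eq_bigr => t' _; rewrite /on_clock !hj eqxx mul1r.
by rewrite big1 // => t' _; rewrite /on_clock !hj eq_sym hh !mul0r.
Qed.

Lemma unitary_controlled A : (forall t, unitary (A t)) -> unitary (controlled A).
Proof.
move=> hA; apply: isometry_unitary => u v; rewrite /ip !sum_join.
rewrite exchange_big [RHS]exchange_big; apply: eq_bigr => t _ /=.
rewrite -[RHS]/(ip (fun h => u (join h t)) (fun h => v (join h t))).
rewrite -(unitary_ip _ _ (hA t)).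
by apply: eq_bigr => h _; rewrite !mapply_controlled.
Qed.

Lemma unitary_on_clock B : unitary B -> unitary (on_clock B).
Proof.
move=> hB; apply: isometry_unitary => u v; rewrite /ip !sum_join.
apply: eq_bigr => h _ /=.
rewrite -[RHS]/(ip (fun t => u (join h t)) (fun t => v (join h t))).
rewrite -(unitary_ip _ _ hB).
by apply: eq_bigr => t _; rewrite !mapply_on_clock.
Qed.

End Clock.

Section IdDiag.
Variables (R : realType) (S : finType).
Local Notation C := R[i].

Definition diag_op (c : S -> C) : op R S := fun s t => (s == t)%:R * c s.

Lemma mapply_diag c v s : mapply (diag_op c) v s = c s * v s.
Proof.
rewrite /mapply (bigD1 s) //= /diag_op eqxx mul1r big1 ?addr0 // => t.
by rewrite eq_sym => /negbTE ->; rewrite !mul0r.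
Qed.

Lemma unitary_diag c : (forall s, (c s)^* * c s = 1) -> unitary (diag_op c).
Proof.
move=> hc; apply: isometry_unitary => u v; apply: eq_bigr => s _.
by rewrite !mapply_diag rmorphM /= mulrACA hc mul1r.
Qed.

End IdDiag.

(** The reflection fixing e + u and negating e - u exchanges the basis vector e with the uniform
    vector u. Its uniform column prepares the clock and its uniform row reads off the average. *)
Lemma uniform_reflection (R : realType) T (t0 : 'I_T) (c : R[i]) :
  c^* = c -> c * c = T%:R^-1 ->
  exists F : op R 'I_T, [/\ unitary F, (forall t, F t t0 = c) & (forall t, F t0 t = c)].
Proof.
move=> cr cc.
have T0 : (T%:R : R[i]) != 0 by rewrite pnatr_eq0 -lt0n (leq_ltn_trans _ (ltn_ord t0)).
pose e := basis_vec R t0; pose u : 'I_T -> R[i] := fun=> c.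
have [F [hF uF Fp Fm]] := reflection_exists (fun=> fun t => e t + u t) 1.
have ee : ip e e = 1 by rewrite -sqnE sqn_basis.
have uu : ip u u = 1.
  by rewrite /ip /u cr cc sumr_const card_ord -[LHS]mulr_natr mulVf.
have eu : ip e u = c by rewrite ip_basisl.
have ue : ip u e = c by rewrite ipC eu.
have Fd : mapply F (fun t => e t - u t) = fun t => - (e t - u t).
  by apply: Fm => i _; rewrite ipDl !ipBr ee uu eu ue; ring.
have Fs := Fp 0%N isT; rewrite mapplyD in Fs; rewrite mapplyB in Fd.
have col t : F t t0 = c.
  have /(congr1 (fun f => f t)) /= := Fs; have /(congr1 (fun f => f t)) /= := Fd.
  rewrite mapply_basis => h1 h2.
  apply: (@mulfI _ (2 : R[i])); first by rewrite pnatr_eq0.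
  transitivity ((F t t0 + mapply F u t) + (F t t0 - mapply F u t)); first by ring.
  by rewrite h1 h2 /u; ring.
by exists F; split=> // t; rewrite hF col cr.
Qed.

Section Algorithm.
Variables (R : realType) (N : nat) (g : pfun N) (d : nat).
Local Notation C := R[i].
Hypotheses (N0 : (0 < N)%N) (d0 : (0 < d)%N).
Variables (M : finType) (a : bits N -> 'I_N -> M -> R).
Hypothesis cost_a : forall x b, g x = Some b -> \sum_i \sum_m a x i m ^+ 2 <= d%:R.
Hypothesis dual_a : forall x y, g x = Some true -> g y = Some false ->
  \sum_i \sum_m (x i != y i)%:R * (a x i m * a y i m) = 1.

Let i0 : 'I_N := Ordinal N0.
Let W := (bool * option M)%type.
Let H : finType := Sp N W.
Let T := (3 * d)%N.
Let T0 : (0 < T)%N. Proof. by rewrite muln_gt0. Qed.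
Let t0 : 'I_T := Ordinal T0.
(** Balances the norms: with eta^2 = 1 / (2 d) the vectors for 1-inputs have squared norm at most 1
    + 1/2, those for 0-inputs at most 1 + 2 d^2. *)
Let eta : R := Num.sqrt (2 * d%:R)^-1.

Let eta2 : eta ^+ 2 = (2 * d%:R)^-1.
Proof. by rewrite sqr_sqrtr // invr_ge0 mulr_ge0. Qed.

Let eta_neq0 : eta != 0.
Proof. by rewrite -sqrf_eq0 eta2 invr_eq0 mulf_neq0 ?pnatr_eq0 // -lt0n. Qed.

(** Complementing the string for 0-inputs turns agreement into x_i <> y_i, and the opposite scalings
    multiply to -1, so the dual constraint makes the two families orthogonal. *)
Let yes_vec x : H -> C := wvec i0 (fun i m => - eta * a x i m) x.
Let no_vec x : H -> C := wvec i0 (fun i m => eta^-1 * a x i m) [ffun i => ~~ x i].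

Let yes_no x y : g x = Some true -> g y = Some false -> ip (yes_vec x) (no_vec y) = 0.
Proof.
move=> gx gy; rewrite ip_wvec -[RHS](rmorph0 (real_complex R)); congr (_%:C%C).
rewrite -[X in X + _](dual_a gx gy); apply/eqP; rewrite addrC addr_eq0 -sumrN; apply/eqP.
apply: eq_bigr => i _; rewrite -sumrN; apply: eq_bigr => m _; rewrite ffunE.
have -> : (x i == ~~ y i) = (x i != y i) by case: (x i); case: (y i).
by field; exact: eta_neq0.
Qed.

Let sqn_yes x : g x = Some true -> sqn (yes_vec x) <= 3 / 2.
Proof.
move=> gx; rewrite sqnE ip_wvec.
have -> : (3 / 2 : C) = (3 / 2)%:C%C by rewrite rmorphM fmorphV !rmorph_nat.
rewrite lecR.
have -> : \sum_i \sum_m (x i == x i)%:R * (- eta * a x i m * (- eta * a x i m))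
   = eta ^+ 2 * \sum_i \sum_m a x i m ^+ 2.
  rewrite mulr_sumr; apply: eq_bigr => i _; rewrite mulr_sumr; apply: eq_bigr => m _.
  by rewrite eqxx /=; ring.
have : eta ^+ 2 * \sum_i \sum_m a x i m ^+ 2 <= eta ^+ 2 * d%:R.
  by apply: ler_wpM2l; [exact: sqr_ge0|exact: cost_a gx].
have -> : eta ^+ 2 * d%:R = 2^-1 by rewrite eta2; field; rewrite pnatr_eq0 -lt0n.
lra.
Qed.

Let sqn_no x : g x = Some false -> sqn (no_vec x) <= (1 + 2 * d%:R ^+ 2)%:C%C.
Proof.
move=> gx; rewrite sqnE ip_wvec lecR lerD2l.
have -> : \sum_i \sum_m ([ffun i0 => ~~ x i0] i == [ffun i0 => ~~ x i0] i)%:R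
     * (eta^-1 * a x i m * (eta^-1 * a x i m))
   = eta ^- 2 * \sum_i \sum_m a x i m ^+ 2.
  rewrite mulr_sumr; apply: eq_bigr => i _; rewrite mulr_sumr; apply: eq_bigr => m _.
  by rewrite eqxx -exprVn /=; ring.
rewrite eta2 invrK expr2 mulrA; apply: ler_wpM2l; last exact: cost_a gx.
by rewrite mulr_ge0.
Qed.

(** [A] reflects about the span of the vectors of all 1-inputs. On a 1-input [yes_vec] is fixed by
    [U x]; on a 0-input the signed [no_vec] exhibits [e0] as a coboundary. The clock superposes the
    iterates of [U x], and the algorithm accepts when the clock returns to [t0]. *)
Lemma dual_computes : computes R g T.
Proof.
pose phi j : H -> C := let x := nth [ffun=> false] (enum (bits N)) j in
  if g x == Some true then yes_vec x else fun=> 0.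
have [A [hA uA A_yes A_no]] := reflection_exists phi #|bits N|.
have {}A_yes x : g x = Some true -> mapply A (yes_vec x) = yes_vec x.
  move=> gx; have := A_yes (index x (enum (bits N))).
  rewrite /phi nth_index ?mem_enum // gx eqxx; apply.
  by rewrite cardE index_mem mem_enum.
have {}A_no x : g x = Some false -> mapply A (no_vec x) = fun h => - no_vec x h.
  move=> gx; apply: A_no => j _; rewrite /phi.
  case: eqP => [gy|_]; first exact: yes_no.
  by rewrite /ip big1 // => h _; rewrite rmorph0 mul0r.
pose U x := comp_op A (diag_op (@wsign R N M x)).
have uU x : unitary (U x).
  apply: unitary_comp => //; apply: unitary_diag => h.
  by rewrite -[RHS](wsign_sq R x h) /wsign rmorphXn rmorphN1.
have UE x v : mapply (U x) v = mapply A (fun h => wsign R x h * v h).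
  by rewrite mapply_comp; congr mapply; apply/funext => h; rewrite mapply_diag.
pose e0 := basis_vec R (origin M i0).
pose c : C := (Num.sqrt T%:R^-1)%:C%C.
have cr : c^* = c by exact: conj_real.
have cc : c * c = T%:R^-1.
  by rewrite /c -rmorphM -expr2 sqr_sqrtr ?invr_ge0 // fmorphV rmorph_nat.
have [F [uF Fcol Frow]] := uniform_reflection t0 cr cc.
(* Multiplied with the phase query this is [wsign x], so one query suffices per iteration. *)
pose csign (h : H) : C := (-1) ^+ (h.1.2 && h.2.1).
(* Branch [t] idles until step T - t and then iterates, so all branches finish together with [t]
   iterations. Queries made while idling are harmless: the origin has answer bit 0. *)
pose ctrl s (t : 'I_T) : op R H :=
  if (T < t + s)%N then comp_op A (diag_op csign) else diag_op (fun=> 1).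
have u1 : unitary (diag_op (fun _ : H => 1 : C)).
  by apply: unitary_diag => h; rewrite rmorph1 mul1r.
have u_ctrl s t : unitary (ctrl s t).
  rewrite /ctrl; case: ifP => _ //; apply: unitary_comp => //.
  apply: unitary_diag => h; rewrite /csign rmorphXn rmorphN1.
  by rewrite -exprD -signr_odd oddD addbb.
pose V s : op R (Sp N (W * 'I_T)%type) :=
  if s is 0 then on_clock F else controlled (ctrl s).
pose V' s := if s == T then comp_op (on_clock F) (V s) else V s.
have uV s : unitary (V s).
  case: s => [|s]; first exact: unitary_on_clock.
  by apply: unitary_controlled => t; exact: u_ctrl.
have uV' s : unitary (V' s).
  rewrite /V'; case: eqP => _ //; apply: unitary_comp => //; exact: unitary_on_clock.
pose init := join (origin M i0) t0.
have runE x s (h : H) t : phase_run V init x s (join h t) =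
    c * iter (t + s - T) (mapply (U x)) e0 h.
  elim: s h t => [|s IH] h t.
    rewrite addn0 (eqP (ltnW (ltn_ord t))) /= mapply_on_clock.
    rewrite (_ : (fun t' => _) = fun t' => e0 h * basis_vec R t0 t'); last first.
      apply/funext => t'; rewrite /basis_vec /init /e0 /join /= !xpair_eqE /=.
      by case: h => [[? ?] [? ?]]; rewrite !xpair_eqE /= -natrM mulnb -!andbA.
    by rewrite mapplyZ mapply_basis Fcol mulrC.
  rewrite [LHS]/= mapply_controlled /ctrl addnS.
  have -> : (fun h' => phase x (phase_run V init x s) (join h' t)) =
      fun h' => c * phase x (iter (t + s - T) (mapply (U x)) e0) h'.
    apply/funext => h'; rewrite /phase /= IH; ring.
  rewrite mapplyZ; congr (_ * _); case: ltnP => hT; rewrite ?ltnS in hT.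
    rewrite subSn // iterS UE mapply_comp; congr (mapply _ _ _).
    apply/funext => h'; rewrite mapply_diag /phase /csign /wsign.
    by case: (h'.1.2) => /=; rewrite ?expr0 ?mul1r //= mulrA -signr_addb.
  rewrite mapply_diag mul1r.
  have -> : (t + s - T = 0)%N by apply/eqP; rewrite subn_eq0 ltnW.
  have -> : ((t + s).+1 - T = 0)%N by apply/eqP; rewrite subn_eq0.
  rewrite /= /phase /e0 /basis_vec; case: eqP => [->|_]; last by rewrite mulr0.
  by rewrite expr0 mul1r.
have run_V' x s : (s < T)%N -> phase_run V' init x s = phase_run V init x s.
  elim: s => [|s IH] sT /=; rewrite /V'; first by rewrite eq_sym (gtn_eqF T0).
  by rewrite (ltn_eqF sT) -/(V' _) IH // ltnW.
have final x (h : H) : phase_run V' init x T (join h t0) = orbit_avg (U x) T e0 h.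
  have h_last s : s = T -> phase_run V' init x s = mapply (on_clock F) (phase_run V init x s).
    case: s => [|s] sT; first by exfalso; move: T0; rewrite -sT.
    rewrite [LHS]/= (run_V' _ _ (eq_leq sT)).
    by rewrite /V' (introT eqP sT) mapply_comp.
  rewrite h_last //.
  rewrite mapply_on_clock /orbit_avg; apply: eq_bigr => t _.
  by rewrite Frow runE addnK mulrA cc.
have prob_yes x :
    \sum_(s | ((s : Sp N (W * 'I_T)%type).2.2 == t0) == true) `|phase_run V' init x T s| ^+ 2
    = sqn (orbit_avg (U x) T e0).
  rewrite big_mkcond sum_join; apply: eq_bigr => h _.
  rewrite (bigD1 t0) //= final big1 ?addr0 // => t /negbTE tt.
  by rewrite tt.
apply: (@phase_computes R N _ g T V' init (fun w => w.2 == t0)) => // x b gx.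
case: b gx => gx.
  rewrite prob_yes; apply: (orbit_avg_fixed (uU x) T0 _ _ (sqn_yes gx)).
    exact: wvec_origin.
  rewrite UE -[RHS](A_yes x gx); congr mapply; apply/funext => h.
  exact: wsign_wvec.
have total : \sum_s `|phase_run V' init x T s| ^+ 2 = 1.
  exact: (@sqn_phase_run _ _ _ V' init x T (fun t _ => uV' t)).
have small : sqn (orbit_avg (U x) T e0) <= 1 / 3.
  pose v h := wsign R x h * no_vec x h.
  have hv h : v h - mapply (U x) v h = 2 * e0 h.
    rewrite UE (_ : (fun h => wsign R x h * v h) = no_vec x); last first.
      by apply/funext => h'; rewrite /v mulrA wsign_sq mul1r.
    rewrite A_no // opprK /v /no_vec wsign_wvecN /e0; ring.
  apply: le_trans (orbit_avg_boundary (uU x) T0 hv _) _.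
  - have -> : sqn v = sqn (no_vec x).
      by apply: eq_bigr => h _; rewrite /v /wsign normrM normrX normrN1 expr1n mul1r.
    exact: sqn_no gx.
  - have -> : ((1 + 2 * d%:R ^+ 2)%:C%C / T%:R ^+ 2 : C)
        = ((1 + 2 * d%:R ^+ 2) / T%:R ^+ 2)%:C%C.
      by rewrite rmorphM fmorphV rmorphXn rmorph_nat.
    have -> : (1 / 3 : C) = (1 / 3)%:C%C by rewrite rmorphM fmorphV rmorph1 rmorph_nat.
    (* (1 + 2 d^2) / (3 d)^2 <= 1/3 since d >= 1; hence the factor 3 in [T]. *)
    rewrite lecR /T natrM ler_pdivrMr; last by rewrite exprn_gt0 // mulr_gt0 // ltr0n.
    have : 1 <= (d%:R : R) by rewrite ler1n.
    nra.
move: total; rewrite (bigID (fun s : Sp N (W * 'I_T)%type => (s.2.2 == t0) == true)) /= prob_yes.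
rewrite (eq_bigl (fun s : Sp N (W * 'I_T)%type => (s.2.2 == t0) == false)); last first.
  by move=> s; case: (s.2.2 == t0).
move=> total; rewrite -(lerD2l (sqn (orbit_avg (U x) T e0))) total.
apply: le_trans (_ : 1 / 3 + 2 / 3 <= _); first by rewrite lerD2r.
by rewrite le_eqVlt; apply/orP; left; apply/eqP; field; rewrite ?pnatr_eq0.
Qed.

End Algorithm.

Lemma feasible_computes (R : realType) N (g : pfun N) d : (0 < N)%N -> (0 < d)%N ->
  feasible g (d%:R : R) -> computes R g (3 * d).
Proof. by move=> N0 d0 [M [a [h1 h2]]]; exact: (dual_computes N0 d0 h1 h2). Qed.

(** * Composition *)

Lemma nbit_ord N (x : bits N) (i : 'I_N) : nbit x i = x i.
Proof. by rewrite /nbit valK. Qed.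

Lemma first_difference (u v : nat -> bool) k :
  (\sum_(l < k) ([forall i : 'I_k, (i < l)%N ==> (u i == v i)] && (u l != v l))
   + [forall i : 'I_k, u i == v i] = 1)%N.
Proof.
pose E l := all (fun i => u i == v i) (iota 0 l).
have Ek l : (l <= k)%N -> [forall i : 'I_k, (i < l)%N ==> (u i == v i)] = E l.
  move=> lk; apply/forallP/allP => [h i|h i].
    rewrite mem_iota /= add0n => il.
    by have /= := h (Ordinal (leq_trans il lk)); rewrite il.
  by apply/implyP => il; apply: h; rewrite mem_iota /= add0n.
have -> : [forall i : 'I_k, u i == v i] = E k.
  rewrite -(Ek k) //; apply: eq_forallb => i; by rewrite ltn_ord.
rewrite (eq_bigr (fun l : 'I_k => E l && (u l != v l) : nat)); last first.
  by move=> l _; rewrite Ek // ltnW.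
elim: k {Ek} => [|k IH]; first by rewrite big_ord0.
rewrite big_ord_recr /= -[RHS]IH -addnA; congr (_ + _)%N.
rewrite /E -addn1 iotaD all_cat /= add0n andbT -/(E k).
by case: (E k); case: (u k); case: (v k).
Qed.

Section Composition.
Variables (R : realType) (n k N : nat) (f : pfun n) (G : pfun N).
(** [pos a] is the location of the array bit returned at address [a], which makes both compositions
    instances of [G]. *)
Variable pos : nat -> nat.
Hypotheses (n0 : (0 < n)%N) (nkN : (n * k <= N)%N).
Hypothesis pos_ge : forall a, (n * k <= pos a)%N.
Hypothesis G_val : forall x b, G x = Some b ->
  exists2 a, inner_index k f x = Some a & nbit x (pos a) = b.

Definition fval (x : bits N) (l : nat) : bool := odflt false (f (block n x l)).
Definition prefix_val (x : bits N) (l : nat) : {ffun 'I_k -> bool} :=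
  [ffun i : 'I_k => (i < l)%N && fval x i].

Lemma inner_indexP x a : inner_index k f x = Some a ->
  (forall l : 'I_k, f (block n x l) = Some (fval x l)) /\
  a = (\sum_(l < k) fval x l * 2 ^ l)%N.
Proof.
rewrite /inner_index; case: ifP => // /forallP h [<-]; split=> // l.
by have := h l; rewrite /fval; case: (f _).
Qed.

Lemma prefix_eq x y l :
  (prefix_val x l == prefix_val y l) =
  [forall i : 'I_k, (i < l)%N ==> (fval x i == fval y i)].
Proof.
apply/eqP/forallP => [/ffunP h i|h].
  by apply/implyP => il; have := h i; rewrite !ffunE il => /eqP.
by apply/ffunP => i; rewrite !ffunE; have := h i; case: (i < l)%N => //= /eqP ->.
Qed.

Lemma inner_pos_lt (q : 'I_k * 'I_n) : (q.1 * n + q.2 < N)%N.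
Proof.
apply: leq_trans nkN; case: q => l j /=.
apply: (@leq_trans (l.+1 * n)); first by rewrite mulSn addnC ltn_add2r.
by rewrite [leqRHS]mulnC leq_mul2r ltn_ord orbT.
Qed.
Definition inner_pos q : 'I_N := Ordinal (inner_pos_lt q).

Definition decode (i : 'I_N) : option ('I_k * 'I_n) :=
  if insub (i %/ n)%N is Some l then
    if insub (i %% n)%N is Some j then Some (l, j) else None
  else None.

Lemma decodeK q : decode (inner_pos q) = Some q.
Proof.
case: q => l j; rewrite /decode /= divnMDl // divn_small // addn0 valK.
by rewrite modnMDl modn_small // valK.
Qed.

Lemma decodeP i q : decode i = Some q -> i = inner_pos q.
Proof.
rewrite /decode; case: insubP => // l _ hl; case: insubP => // j _ hj [<-].
by apply: val_inj => /=; rewrite hl hj -divn_eq.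
Qed.

Lemma decode_ge (i : 'I_N) : (n * k <= i)%N -> decode i = None.
Proof.
move=> h; case e: (decode i) => [q|] //; move: h; rewrite (decodeP e) /= leqNgt.
case: q {e} => l j; rewrite (@leq_trans (l.+1 * n)) //=; first by rewrite mulSn addnC ltn_add2r.
by rewrite mulnC leq_mul2l ltn_ord orbT.
Qed.

Lemma block_inner x (q : 'I_k * 'I_n) : block n x q.1 q.2 = x (inner_pos q).
Proof. by rewrite ffunE -(nbit_ord x (inner_pos q)). Qed.

Lemma sum_decode (F : 'I_N -> R) :
  \sum_i F i = \sum_(q : 'I_k * 'I_n) F (inner_pos q) + \sum_(i | decode i == None) F i.
Proof.
rewrite (bigID (fun i => decode i == None)) /= addrC; congr (_ + _).
rewrite (reindex_omap inner_pos decode) /=.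
  by apply: eq_bigl => q; rewrite decodeK /= eqxx.
by move=> i; case e: (decode i) => [q|] //= _; rewrite (decodeP e).
Qed.

Variables (M : finType) (d : R) (a : bits n -> 'I_n -> M -> R).
Hypothesis cost_a : forall x b, f x = Some b -> \sum_i \sum_m a x i m ^+ 2 <= d.
Hypothesis dual_a : forall x y, f x = Some true -> f y = Some false ->
  \sum_i \sum_m (x i != y i)%:R * (a x i m * a y i m) = 1.

Let M' : finType := ({ffun 'I_k -> bool} * option (M * bool))%type.
Let Gval x := odflt false (G x).

(** Block l carries the solution for [f], tagged with the preceding inner values and with one bit.
    For inputs of different [G] value the bits agree exactly when the l-th inner values differ, so
    only the block of first difference survives. A unit entry at the addressed array cell, tagged
    with all inner values, handles pairs with the same address. The tags do not add to the cost. *)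
Definition comp_vec (x : bits N) (i : 'I_N) (w : M') : R :=
  match decode i, w.2 with
  | Some q, Some mc => ((w.1 == prefix_val x q.1) && (mc.2 == fval x q.1 (+) ~~ Gval x))%:R
                       * a (block n x q.1) q.2 mc.1
  | None, None => ((w.1 == prefix_val x k)
                   && (odflt 0%N (omap pos (inner_index k f x)) == i))%:R
  | _, _ => 0
  end.

Lemma comp_vec_inner x y (q : 'I_k * 'I_n) :
  \sum_w comp_vec x (inner_pos q) w * comp_vec y (inner_pos q) w =
  ((prefix_val x q.1 == prefix_val y q.1) &&
   (fval x q.1 (+) ~~ Gval x == fval y q.1 (+) ~~ Gval y))%:R *
  \sum_m a (block n x q.1) q.2 m * a (block n y q.1) q.2 m.
Proof.
transitivity (\sum_(s : {ffun 'I_k -> bool}) \sum_(o : option (M * bool))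
    comp_vec x (inner_pos q) (s, o) * comp_vec y (inner_pos q) (s, o)).
  by rewrite pair_bigA; apply: eq_bigr => -[].
rewrite (sum_pointed (j0 := prefix_val x q.1)); last first.
  move=> s /negbTE hs; rewrite big1 // => -[o|] _; rewrite /comp_vec decodeK /= ?mul0r //.
  by rewrite hs /= !mul0r.
rewrite sum_option {1}/comp_vec decodeK /= mul0r add0r.
transitivity (\sum_m \sum_c
    comp_vec x (inner_pos q) (prefix_val x q.1, Some (m, c)) *
    comp_vec y (inner_pos q) (prefix_val x q.1, Some (m, c))).
  by rewrite pair_bigA; apply: eq_bigr => -[].
rewrite mulr_sumr; apply: eq_bigr => m _.
rewrite (sum_pointed (j0 := fval x q.1 (+) ~~ Gval x)); last first.
  by move=> c /negbTE hc; rewrite /comp_vec decodeK /= hc andbF !mul0r.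
by rewrite /comp_vec decodeK /= !eqxx mul1r; ring.
Qed.

Lemma comp_vec_outer x y i : decode i = None ->
  \sum_w comp_vec x i w * comp_vec y i w =
  ((prefix_val x k == prefix_val y k) &&
   (odflt 0%N (omap pos (inner_index k f x)) == i) &&
   (odflt 0%N (omap pos (inner_index k f y)) == i))%:R.
Proof.
move=> hi.
transitivity (\sum_(s : {ffun 'I_k -> bool}) \sum_(o : option (M * bool))
    comp_vec x i (s, o) * comp_vec y i (s, o)).
  by rewrite pair_bigA; apply: eq_bigr => -[].
rewrite (sum_pointed (j0 := prefix_val x k)); last first.
  move=> s /negbTE hs; rewrite big1 // => -[o|] _; rewrite /comp_vec hi /= ?mul0r //.
  by rewrite hs /= !mul0r.
rewrite sum_option {1 2}/comp_vec hi /= eqxx /= big1 ?addr0; last first.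
  by move=> o _; rewrite /comp_vec hi mul0r.
by rewrite -natrM mulnb andbCA andbA.
Qed.

Lemma sum_hit_le1 (P : pred 'I_N) p : \sum_(i | P i) (p == i :> nat)%:R <= 1 :> R.
Proof.
rewrite big_mkcond; case: (ltnP p N) => [pN|Np].
  rewrite (sum_pointed (j0 := Ordinal pN)) /=; first by rewrite eqxx; case: ifP.
  by move=> i; rewrite -val_eqE /= eq_sym => /negbTE ->; case: ifP.
rewrite big1 // => i _; case: ifP => // _.
by rewrite gtn_eqF // (leq_trans (ltn_ord i)).
Qed.

Lemma comp_feasible : feasible G (k%:R * d + 1).
Proof.
exists M', comp_vec; split=> [x b Gx|x y Gx Gy].
  have [ax hx _] := G_val Gx; have [fx _] := inner_indexP hx.
  under eq_bigr do under eq_bigr do rewrite expr2.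
  rewrite sum_decode lerD //.
    under eq_bigr do rewrite comp_vec_inner !eqxx mul1r.
    rewrite -(pair_bigA _ (fun (l : 'I_k) (j : 'I_n) =>
       \sum_m a (block n x l) j m * a (block n x l) j m)) /=.
    apply: le_trans (_ : \sum_(l < k) d <= _); last first.
      by rewrite sumr_const card_ord mulr_natl.
    apply: ler_sum => l _; apply: le_trans (cost_a (fx l)).
    by apply: ler_sum => j _; apply: ler_sum => m _; rewrite expr2.
  rewrite (eq_bigr (fun i : 'I_N => ((pos ax == i)%:R : R))); last first.
    by move=> i /eqP hi; rewrite comp_vec_outer // !eqxx hx /= andbb.
  exact: sum_hit_le1.
have [ax hx bx] := G_val Gx; have [fx eax] := inner_indexP hx.
have [ay hy byy] := G_val Gy; have [fy eay] := inner_indexP hy.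
rewrite (eq_bigr (fun i => (x i != y i)%:R * \sum_w comp_vec x i w * comp_vec y i w)); last first.
  by move=> i _; rewrite mulr_sumr.
rewrite sum_decode.
have -> : \sum_(i | decode i == None) (x i != y i)%:R * (\sum_w comp_vec x i w * comp_vec y i w)
   = ([forall i : 'I_k, fval x i == fval y i])%:R.
  have -> : [forall i : 'I_k, fval x i == fval y i] = (prefix_val x k == prefix_val y k).
    by rewrite prefix_eq; apply: eq_forallb => i; rewrite ltn_ord.
  rewrite (eq_bigr (fun i : 'I_N => ((x i != y i) && (prefix_val x k == prefix_val y k) &&
     (pos ax == i) && (pos ay == i))%:R)); last first.
    move=> i /eqP hi; rewrite comp_vec_outer // hx hy /= -natrM mulnb.
    by rewrite -!andbA.
  case: eqP => [exy|_]; last by rewrite big1 // => i _; rewrite andbF.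
  have eaxy : ax = ay.
    rewrite eax eay; apply: eq_bigr => l _; congr (nat_of_bool _ * _)%N.
    by have /ffunP/(_ l) := exy; rewrite !ffunE ltn_ord.
  (* Beyond [N] the default of [nbit] is false, whereas this bit is true. *)
  have pN : (pos ax < N)%N.
    rewrite ltnNge; apply/negP => h; move: bx; rewrite /nbit insubF //.
    exact: leq_gtF.
  rewrite big_mkcond (sum_pointed (j0 := Ordinal pN)); last first.
    move=> i; rewrite -val_eqE /= eq_sym => /negbTE ->.
    by rewrite andbF /=; case: ifP.
  rewrite decode_ge //= eqxx -eaxy !eqxx !andbT.
  by rewrite -!(nbit_ord _ (Ordinal pN)) /= bx eaxy byy.
rewrite -[RHS]/(1%:R) -(first_difference (fval x) (fval y) k) natrD natr_sum; congr (_ + _).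
transitivity (\sum_(l < k) \sum_(j < n) ((prefix_val x l == prefix_val y l) && (fval x l != fval y l))%:R *
   \sum_m (block n x l j != block n y l j)%:R * (a (block n x l) j m * a (block n y l) j m)).
  rewrite pair_bigA; apply: eq_bigr => q _ /=; rewrite comp_vec_inner -!block_inner mulrCA.
  congr (_%:R * _); last by rewrite mulr_sumr.
  by rewrite /Gval Gx Gy /= addbF addbT; case: (fval x _); case: (fval y _).
apply: eq_bigr => l _; rewrite -prefix_eq -mulr_sumr.
case: (prefix_val x l == _) => /=; last by rewrite mul0r.
have := fx l; have := fy l; case: (fval x l); case: (fval y l) => //= h1 h2; rewrite ?mul0r //.
  by rewrite mul1r dual_a.
rewrite mul1r; apply: etrans (dual_a h1 h2); apply: eq_bigr => j _; apply: eq_bigr => m _.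
by rewrite eq_sym; congr (_ * _); exact: mulrC.
Qed.

End Composition.

Lemma IndComp_val n k (f : pfun n) x b : @IndComp n k f x = Some b ->
  exists2 a, inner_index k f x = Some a & nbit x (n * k + a) = b.
Proof. by rewrite /IndComp; case: (inner_index k f x) => //= a [<-]; exists a. Qed.

Lemma UIndComp_val n k (f : pfun n) x b : @UIndComp n k f x = Some b ->
  exists2 a, inner_index k f x = Some a & nbit x (n * k + 2 * a) = b.
Proof.
rewrite /UIndComp; case: (inner_index k f x) => //= a; case: ifP => // _ [<-].
by exists a.
Qed.

Lemma IndComp_feasible (R : realType) n k (f : pfun n) (d : R) : (0 < n)%N ->
  feasible f d -> feasible (@IndComp n k f) (k%:R * d + 1).
Proof.
move=> n0 [M [a [h1 h2]]].
apply: (comp_feasible n0 (leq_addr _ _) _ (@IndComp_val n k f) h1 h2).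
by move=> b; exact: leq_addr.
Qed.

Lemma UIndComp_feasible (R : realType) n k (f : pfun n) (d : R) : (0 < n)%N ->
  feasible f d -> feasible (@UIndComp n k f) (k%:R * d + 1).
Proof.
move=> n0 [M [a [h1 h2]]].
apply: (comp_feasible n0 (leq_addr _ _) _ (@UIndComp_val n k f) h1 h2).
by move=> b; exact: leq_addr.
Qed.

(** * From computing to separating *)

Section Separate.
Variables (R : realType) (N : nat) (g : pfun N) (T : nat) (W : finType).
Variables (U : nat -> op R (Sp N W)) (init : Sp N W) (out : Sp N W -> bool).
Local Notation C := R[i].
Hypothesis unitU : forall t, (t <= T)%N -> unitary (U t).
Hypothesis outU : forall x b, g x = Some b ->
  2 / 3 <= \sum_(s | out s == b) `|run U init x T s| ^+ 2.

Let S' := Sp N (bool * W)%type.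

Definition add_bit (c : bool) (h : Sp N W) : S' := (h.1, (c, h.2)).
Definition drop_bit (s : S') : Sp N W := (s.1, s.2.2).
Definition out_flag t (h : Sp N W) : bool := (t == T) && out h.

(** [U t], followed at the last step only by copying the output bit into a fresh register, which is
    the one that is kept. The reduced state is then diagonal with the output probabilities. *)
Definition copy_out t : op R S' := fun s' s =>
  (s.2.1 == s'.2.1 (+) out_flag t (drop_bit s'))%:R * U t (drop_bit s') (drop_bit s).

Lemma sum_add_bit (F : S' -> C) : \sum_s F s = \sum_h \sum_c F (add_bit c h).
Proof.
rewrite pair_big /= (reindex (fun q : Sp N W * bool => add_bit q.2 q.1)) //=.
by exists (fun s => (drop_bit s, s.2.1)) => [[[? ?] ?]|[? [? ?]]].
Qed.

Lemma drop_add c h : drop_bit (add_bit c h) = h. Proof. by case: h. Qed.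

Lemma mapply_copy_out t v c h :
  mapply (copy_out t) v (add_bit c h) =
  mapply (U t) (fun h' => v (add_bit (c (+) out_flag t h) h')) h.
Proof.
rewrite /mapply sum_add_bit; apply: eq_bigr => h' _.
rewrite (bigD1 (c (+) out_flag t h)) //= /copy_out !drop_add /= eqxx mul1r.
by rewrite big1 ?addr0 // => c' /negbTE ->; rewrite !mul0r.
Qed.

Lemma unitary_copy_out t : (t <= T)%N -> unitary (copy_out t).
Proof.
move=> tT; apply: isometry_unitary => u v; rewrite /ip !sum_add_bit.
transitivity (\sum_(c : bool) ip (mapply (U t) (fun h => u (add_bit c h)))
                                 (mapply (U t) (fun h => v (add_bit c h)))); last first.
  rewrite [RHS]exchange_big; apply: eq_bigr => c _.
  by rewrite unitary_ip //; exact: unitU.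
rewrite /ip [RHS]exchange_big; apply: eq_bigr => h _ /=.
rewrite !big_bool !mapply_copy_out.
by case: (out_flag t h) => //=; rewrite addrC.
Qed.

Lemma run_copy_out x t c h : (t <= T)%N ->
  run copy_out (add_bit false init) x t (add_bit c h) =
  (c == out_flag t h)%:R * run U init x t h.
Proof.
elim: t c h => [|t IH] c h tT /=; rewrite mapply_copy_out.
  transitivity (mapply (U 0) (fun h' => (c == out_flag 0 h)%:R * basis_vec R init h') h);
    last by rewrite mapplyZ.
  congr (mapply _ _ _); apply/funext => h'.
  rewrite /basis_vec /add_bit; case: h' => q w; case: init => q' w' /=.
  rewrite !xpair_eqE -natrM mulnb /= andbCA; congr (nat_of_bool (_ && _))%:R.
  by case: c; case: (out_flag _ _).
transitivity (mapply (U t.+1) (fun h' => (c == out_flag t.+1 h)%:R *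
    mapply (oracle R x) (run U init x t) h') h); last by rewrite mapplyZ.
congr (mapply _ _ _); apply/funext => h'; rewrite !mapply_oracle.
rewrite -[X in run _ _ _ _ X]/(add_bit (c (+) out_flag t.+1 h)
   ((h'.1.1, h'.1.2 (+) x h'.1.1), h'.2)) IH; last exact: ltnW.
congr (_%:R * _); rewrite {2}/out_flag (ltn_eqF tT) /=.
by case: c; case: (out_flag _ _).
Qed.

Definition out_prob x b : C := \sum_(s | out s == b) `|run U init x T s| ^+ 2.

Lemma reduced_copy_out x a a' :
  reduced (run copy_out (add_bit false init) x T) a a' = (a == a')%:R * out_prob x a.
Proof.
rewrite /reduced /out_prob pair_big /= [in RHS]big_mkcond mulr_sumr; apply: eq_bigr => h _.
rewrite -[in X in X * _]/(add_bit a h) -[in X in _ * X]/(add_bit a' h) !run_copy_out //.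
rewrite /out_flag eqxx /= rmorphM rmorph_nat /= normCK eq_sym.
case: (eqVneq (out h) a) => [<-|]; last by rewrite !mul0r mulr0.
rewrite [a' == _]eq_sym /=; ring.
Qed.

Lemma out_prob_sum x b : out_prob x b + out_prob x (~~ b) = 1.
Proof.
have := @sqn_run R N W U init x T unitU T (leqnn T).
rewrite /sqn (bigID (fun s => out s == b)) /= => <-; congr (_ + _).
by apply: eq_bigl => s; case: (out s) b => -[].
Qed.

Lemma out_prob_ge0 x b : 0 <= out_prob x b.
Proof. by apply: sumr_ge0 => s _; rewrite exprn_ge0. Qed.

Lemma separates_copy_out : separates R g T.
Proof.
exists bool, W, copy_out, (add_bit false init); split; first exact: unitary_copy_out.
move=> x y bx byy gx gy ne.
pose D a := out_prob x a - out_prob y a.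
have realD a : D a \is Num.real by rewrite rpredB // ger0_real // out_prob_ge0.
exists (\sum_a `|D a|); split.
  pose sg a : C := if 0 <= D a then 1 else -1.
  have sgD a : D a = `|D a| * sg a.
    rewrite /sg; case: ifP => [h|]; first by rewrite ger0_norm // mulr1.
    by rewrite real_leNgt // ?rpred0 // => /negbFE h; rewrite ltr0_norm // mulrN1 opprK.
  have sgc a : (sg a)^* = sg a by rewrite /sg; case: ifP; rewrite ?rmorphN rmorph1.
  have sg2 a : sg a * sg a = 1 by rewrite /sg; case: ifP; rewrite ?mulrNN mulr1.
  exists (diag_op (fun=> 1)), (diag_op sg), (fun a => `|D a|); split=> //.
  - by apply: unitary_diag => a; rewrite rmorph1 mul1r.
  - by apply: unitary_diag => a; rewrite sgc sg2.
  - move=> a a'; rewrite !reduced_copy_out -mulrBr.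
    rewrite (bigD1 a) //= big1 ?addr0 => [|j /negbTE ja]; last first.
      by rewrite /diag_op eq_sym ja !mul0r.
    rewrite /diag_op eqxx mul1r rmorphM rmorph_nat /= sgc.
    case: (eqVneq a a') => [<-|]; last by rewrite !mul0r mulr0.
    by rewrite !mul1r -sgD.
have hx := outU gx; have hy := outU gy.
have eb : byy = ~~ bx by case: bx byy ne {gx gy hx hy} => -[].
(* Half of this single entry already gives the required 1/6. *)
have hD : 1 / 3 <= `|D bx|.
  apply: le_trans (real_ler_norm (realD bx)).
  rewrite /D; have := out_prob_sum y bx; rewrite -eb => e.
  have -> : out_prob y bx = 1 - out_prob y byy by rewrite -e addrK.
  rewrite -subr_ge0.
  have : 0 <= (out_prob x bx - 2 / 3) + (out_prob y byy - 2 / 3).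
    by rewrite addr_ge0 // subr_ge0.
  suff -> : out_prob x bx - 2 / 3 + (out_prob y byy - 2 / 3)
     = out_prob x bx - (1 - out_prob y byy) - 1 / 3 by [].
  by field; rewrite ?pnatr_eq0.
apply: (@le_trans _ _ (`|D bx| / 2)); last first.
  rewrite ler_pM2r ?invr_gt0 ?ltr0n // (bigD1 bx) //= lerDl.
  by apply: sumr_ge0 => a _.
apply: (@le_trans _ _ ((1 / 3) / 2)); last by rewrite ler_pM2r ?invr_gt0 ?ltr0n.
by rewrite le_eqVlt; apply/orP; left; apply/eqP; field; rewrite ?pnatr_eq0.
Qed.

End Separate.

Lemma computes_separates (R : realType) N (g : pfun N) T :
  computes R g T -> separates R g T.
Proof. by move=> [W [U [init [out [h1 h2]]]]]; exact: (separates_copy_out h1 h2). Qed.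

(** * The hybrid argument *)

Section Hybrid.
Variables (R : realType) (N : nat) (W : finType).
Local Notation C := R[i].

Definition mass (A : pred 'I_N) (v : Sp N W -> C) : C := \sum_(s | A s.1.1) `|v s| ^+ 2.

Lemma oracle_diff (A : pred 'I_N) (x y : bits N) (v : Sp N W -> C) :
  (forall i, ~~ A i -> x i = y i) ->
  sqn (fun s => mapply (oracle R x) v s - mapply (oracle R y) v s) <= 4 * mass A v.
Proof.
move=> h; rewrite /sqn /mass [in leRHS]big_mkcond !sum_Sp mulr_sumr.
apply: ler_sum => -[i w] _; rewrite !mapply_oracle /=.
case: ifP => Ai; last by rewrite h ?Ai // !subrr normr0 expr0n addr0 mulr0.
have key (a b : C) : `|a - b| ^+ 2 <= 2 * (`|a| ^+ 2 + `|b| ^+ 2).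
  have := @normD_sq R a (- b) 1 ltr01; rewrite normrN invr1 -mulrDr //.
have two (a b : C) : `|a - b| ^+ 2 + `|b - a| ^+ 2 <= 4 * (`|a| ^+ 2 + `|b| ^+ 2).
  apply: le_trans (lerD (key a b) (key b a)) _.
  by rewrite (addrC (`|b| ^+ 2)) -mulrDl -natrD.
have nn (a b : C) : 0 <= 4 * (`|a| ^+ 2 + `|b| ^+ 2).
  by rewrite mulr_ge0 // addr_ge0 // exprn_ge0.
by case: (x i); case: (y i) => //=; rewrite ?subrr ?normr0 ?expr0n ?addr0 ?nn //= addrC.
Qed.

(** The query weight is measured along the run on [y] alone, so [y] may be an input on which nothing
    is assumed about the algorithm. *)
Lemma run_diff (A : pred 'I_N) (U : nat -> op R (Sp N W)) init (x y : bits N) T :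
  (forall t, (t <= T)%N -> unitary (U t)) -> (forall i, ~~ A i -> x i = y i) ->
  forall t, (t <= T)%N ->
  sqn (fun s => run U init x t s - run U init y t s)
  <= t%:R * (4 * \sum_(j < t) mass A (run U init y j)).
Proof.
move=> hU hxy; elim=> [|t IH] tT.
  by rewrite mul0r /= /sqn big1 // => s _; rewrite subrr normr0 expr0n.
pose e s := run U init x t s - run U init y t s.
pose dl s := mapply (oracle R x) (run U init y t) s - mapply (oracle R y) (run U init y t) s.
have -> : sqn (fun s => run U init x t.+1 s - run U init y t.+1 s) =
   sqn (fun s => mapply (oracle R x) e s + dl s).
  rewrite /= -mapplyB unitary_sqn; last exact: hU.
  by congr sqn; apply/funext => s; rewrite mapplyB /dl addrA subrK.
have dl_le : sqn dl <= 4 * mass A (run U init y t) by exact: oracle_diff.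
have {}IH := IH (ltnW tT); rewrite -/e in IH.
(* The weight t in [sqnD] has to be positive; for later steps (1 + 1/t) t = 1 + t makes the bound
   exactly additive. *)
case: t => [|t] in tT e dl dl_le IH *.
  have e0 s : e s = 0 by rewrite /e /= subrr.
  rewrite big_ord1 mul1r; apply: le_trans dl_le.
  rewrite (_ : (fun s => _) = dl) //; apply/funext => s.
  by rewrite mapply_oracle e0 add0r.
have t0 : 0 < (t.+1%:R : C) by rewrite ltr0n.
apply: le_trans (sqnD _ _ t0) _.
rewrite sqn_oracle.
apply: le_trans (_ : (1 + t.+1%:R^-1) * (t.+1%:R * (4 * \sum_(j < t.+1) mass A (run U init y j)))
   + (1 + t.+1%:R) * (4 * mass A (run U init y t.+1)) <= _).
  by apply: lerD; apply: ler_wpM2l => //; rewrite addr_ge0 // ?invr_ge0 ltW.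
rewrite le_eqVlt; apply/orP; left; apply/eqP.
rewrite [in RHS]big_ord_recr /= -[t.+2%:R]natr1; field.
by rewrite addrC natr1 pnatr_eq0.
Qed.

End Hybrid.

(** * Trace distance of reduced states against distance of vectors *)

Section TraceDistance.
Variables (R : realType).
Local Notation C := R[i].

(** The squared norm of v - U U^* v is |v|^2 - |U^* v|^2, using U^* U = I only. *)
Lemma bessel (K : finType) (U : op R K) (v : K -> C) : unitary U ->
  sqn (fun j => \sum_a (U a j)^* * v a) <= sqn v.
Proof.
move=> hU; pose al j := \sum_a (U a j)^* * v a.
have := sqn_ge0 (fun a => v a - mapply U al a).
have e1 : ip v (mapply U al) = sqn al.
  rewrite /mapply; transitivity (\sum_j al j * ip v (fun a => U a j)).
    by rewrite -ip_sumr; apply: eq_bigr => a _; congr (_ * _); apply: eq_bigr => j _; rewrite mulrC.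
  apply: eq_bigr => j _; rewrite normCK; congr (_ * _).
  by rewrite ipC /ip.
have e2 : ip (mapply U al) v = sqn al.
  by rewrite ipC e1; apply/conj_Creal; rewrite ger0_real // sqn_ge0.
rewrite sqnE ipBl !ipBr e1 e2 unitary_ip // -!sqnE subrr subr0 subr_ge0.
exact.
Qed.

Variables (N : nat) (K D : finType).
Local Notation S := (Sp N (K * D)%type).

Definition rotate (U : op R K) (psi : S -> C) : S -> C :=
  fun s => \sum_a (U a s.2.1)^* * psi (s.1, (a, s.2.2)).

Lemma sum_reg (F : S -> C) :
  \sum_s F s = \sum_(q : 'I_N * bool) \sum_(d : D) \sum_(a : K) F (q, (a, d)).
Proof.
transitivity (\sum_(q : 'I_N * bool) \sum_(w : K * D) F (q, w)).
  by rewrite pair_bigA; apply: eq_bigr => -[].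
apply: eq_bigr => q _; rewrite exchange_big /= pair_bigA.
by apply: eq_bigr => -[].
Qed.

Lemma sqn_rotate U psi : unitary U -> sqn (rotate U psi) <= sqn psi.
Proof.
move=> hU; rewrite /sqn !sum_reg; apply: ler_sum => q _; apply: ler_sum => d _.
exact: (@bessel K U (fun a => psi (q, (a, d)))).
Qed.

Lemma rotateB U u v s :
  rotate U (fun s => u s - v s) s = rotate U u s - rotate U v s.
Proof. by rewrite /rotate -sumrB; apply: eq_bigr => a _; rewrite mulrBr. Qed.

Lemma ip_rotate U V psi :
  ip (rotate V psi) (rotate U psi) =
  \sum_j \sum_a \sum_a' (U a j)^* * reduced psi a a' * V a' j.
Proof.
rewrite /ip sum_reg.
transitivity (\sum_(q : 'I_N * bool) \sum_d \sum_j \sum_a \sum_a'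
   (U a j)^* * (psi (q, (a, d)) * (psi (q, (a', d)))^*) * V a' j).
  apply: eq_bigr => q _; apply: eq_bigr => d _; apply: eq_bigr => j _ /=.
  rewrite /rotate /= rmorph_sum mulr_suml exchange_big /= exchange_big /=.
  rewrite exchange_big /=; apply: eq_bigr => a' _.
  rewrite mulr_sumr; apply: eq_bigr => a _.
  rewrite rmorphM /= conjCK; ring.
under eq_bigr do rewrite exchange_big /=.
rewrite exchange_big /=; apply: eq_bigr => j _.
under eq_bigr do rewrite exchange_big /=.
rewrite exchange_big /=; apply: eq_bigr => a _.
under eq_bigr do rewrite exchange_big /=.
rewrite exchange_big /=; apply: eq_bigr => a' _.
rewrite /reduced mulr_sumr mulr_suml; apply: eq_bigr => q _.
by rewrite mulr_sumr mulr_suml.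
Qed.

(** By the singular value decomposition the trace norm is the difference of the overlaps of V^* psi
    with U^* psi, for the two states; bilinearity writes it as two overlaps that each involve psi1 -
    psi2. *)
Lemma trace_dist_le (psi1 psi2 : S -> C) : sqn psi1 = 1 -> sqn psi2 = 1 ->
  trace_dist_ge (reduced psi1) (reduced psi2) (1 / 6) ->
  1 / 36 <= sqn (fun s => psi1 s - psi2 s).
Proof.
move=> n1 n2 [v [[U [V [sg [hU hV sg0 hA ->]]]] hv]].
have ev : \sum_j sg j = ip (rotate V psi1) (rotate U psi1) - ip (rotate V psi2) (rotate U psi2).
  rewrite !ip_rotate -sumrB; apply: eq_bigr => j _.
  transitivity (\sum_i sg i * (\sum_a (U a j)^* * U a i) * (\sum_a (V a i)^* * V a j)).
    rewrite (sum_pointed (j0 := j)) => [|i /negbTE ij].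
      by rewrite hU hV eqxx !mulr1.
    by rewrite hU eq_sym ij mulr0 mul0r.
  rewrite -sumrB.
  transitivity (\sum_a \sum_i \sum_a' (U a j)^* * (U a i * sg i * (V a' i)^*) * V a' j).
    rewrite exchange_big; apply: eq_bigr => i _ /=.
    rewrite [sg i * _]mulr_sumr mulr_suml; apply: eq_bigr => a _.
    by rewrite mulr_sumr; apply: eq_bigr => a' _; ring.
  apply: eq_bigr => a _; rewrite exchange_big -sumrB; apply: eq_bigr => a' _ /=.
  by rewrite -mulrBl -mulrBr hA mulr_sumr mulr_suml.
pose dp s := psi1 s - psi2 s.
have dU s : rotate U dp s = rotate U psi1 s - rotate U psi2 s by exact: rotateB.
have dV s : rotate V dp s = rotate V psi1 s - rotate V psi2 s by exact: rotateB.
have {}ev : \sum_j sg j = ip (rotate V psi1) (rotate U dp) + ip (rotate V dp) (rotate U psi2).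
  rewrite ev (_ : rotate U dp = fun s => rotate U psi1 s - rotate U psi2 s); last exact/funext.
  rewrite (_ : rotate V dp = fun s => rotate V psi1 s - rotate V psi2 s); last exact/funext.
  by rewrite ipBr ipBl; ring.
have s6 : 0 < (6^-1 : C) by rewrite invr_gt0 ltr0n.
(* Weights 1/6 and 6 yield 1/3 <= 1/6 + 6 |psi1 - psi2|^2. *)
have b1 := @norm_ip_le R _ (rotate V psi1) (rotate U dp) 6^-1 s6.
have b2 := @norm_ip_le R _ (rotate V dp) (rotate U psi2) 6 (ltr0n _ 6).
have r1 : sqn (rotate V psi1) <= 1 by rewrite -n1 sqn_rotate.
have r2 : sqn (rotate U psi2) <= 1 by rewrite -n2 sqn_rotate.
have r3 := sqn_rotate dp hU; have r4 := sqn_rotate dp hV.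
have v_le : \sum_j sg j <= 6^-1 + 6 * sqn dp.
  rewrite -[leLHS]ger0_norm; last by apply: sumr_ge0.
  rewrite ev; apply: le_trans (ler_normD _ _) _.
  apply: le_trans (lerD b1 b2) _; rewrite invrK -mulrDl.
  rewrite ler_pdivrMr ?ltr0n //.
  apply: le_trans (_ : (6^-1 * 1 + 6 * sqn dp) + (6 * sqn dp + 6^-1 * 1) <= _).
    by apply: lerD; apply: lerD; apply: ler_wpM2l => //; rewrite ?invr_ge0 ltW // ltr0n.
  by rewrite le_eqVlt; apply/orP; left; apply/eqP; ring.
have h : 1 / 6 * 2 <= 6^-1 + 6 * sqn dp.
  by apply: le_trans v_le; rewrite -ler_pdivlMr ?ltr0n.
have -> : (1 / 36 : C) = (1 / 6 * 2 - 6^-1) / 6 by field; rewrite ?pnatr_eq0.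
by rewrite ler_pdivrMr ?ltr0n // lerBlDl -/dp [sqn dp * _]mulrC.
Qed.

End TraceDistance.

(** * Query weight on the address *)

Lemma binary_lt k (b : 'I_k -> bool) : (\sum_(j < k) b j * 2 ^ j < 2 ^ k)%N.
Proof.
elim: k b => [|k IH] b; first by rewrite big_ord0.
rewrite big_ord_recl /= expn0 muln1.
have -> : (\sum_(i < k) b (lift ord0 i) * 2 ^ bump 0 i =
   2 * \sum_(i < k) b (lift ord0 i) * 2 ^ i)%N.
  by rewrite big_distrr; apply: eq_bigr => i _; rewrite /= /bump leq0n add1n expnS mulnCA.
have := IH (fun i => b (lift ord0 i)); rewrite expnS; case: (b ord0) => /=; lia.
Qed.

Lemma binary_digit k (b : 'I_k -> bool) (l : 'I_k) :
  odd ((\sum_(j < k) b j * 2 ^ j) %/ 2 ^ l) = b l.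
Proof.
elim: k b l => [b [] //|k IH] b l.
rewrite big_ord_recl /= expn0 muln1.
have -> : (\sum_(i < k) b (lift ord0 i) * 2 ^ bump 0 i =
   (\sum_(i < k) b (lift ord0 i) * 2 ^ i) * 2)%N.
  by rewrite big_distrl; apply: eq_bigr => i _; rewrite /= /bump leq0n add1n expnS mulnA mulnAC.
case: (unliftP ord0 l) => [j|] -> /=; last first.
  by rewrite expn0 divn1 oddD oddM andbF addbF oddb.
rewrite /bump leq0n add1n expnS divnMA addnC divnMDl //.
rewrite (divn_small (_ : (b ord0 < 2)%N)) ?addn0; last by case: (b ord0).
exact: (IH (fun i => b (lift ord0 i))).
Qed.

Section QueryWeight.
Variables (R : realType) (n k N : nat) (f : pfun n) (G : pfun N).
Hypotheses (nkN : (n * k <= N)%N).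
Local Notation Z := {ffun 'I_k -> bits n}.
Local Notation C := R[i].

Definition set_bits (z : Z) (S : nat -> bool) : bits N :=
  [ffun i : 'I_N => if decode n k i is Some q then z q.1 q.2 else S i].

Lemma block_set_bits z S (l : 'I_k) : block n (set_bits z S) l = z l.
Proof.
apply/ffunP => j.
rewrite (block_inner nkN (set_bits z S) (l, j)).
by rewrite ffunE decodeK //; exact: leq_ltn_trans (ltn_ord j).
Qed.

Lemma nbit_set_bits z S p : (n * k <= p)%N -> (p < N)%N -> nbit (set_bits z S) p = S p.
Proof.
move=> kp pN; rewrite -[p]/(val (Ordinal pN)) nbit_ord ffunE.
by rewrite (decode_ge nkN).
Qed.

Definition address (z : Z) : nat := (\sum_(l < k) (f (z l) == Some true) * 2 ^ l)%N.

Lemma inner_index_set_bits (z : Z) S : (forall l, f (z l) != None) ->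
  inner_index k f (set_bits z S) = Some (address z).
Proof.
move=> hz; rewrite /inner_index; case: ifP => [_|/negbT/forallPn [l]]; last first.
  by rewrite block_set_bits hz.
congr Some; apply: eq_bigr => l _; rewrite block_set_bits.
by have := hz l; case: (f (z l)) => [[]|].
Qed.

(** [S1 a] and [S2 a] are array contents with values false and true at address [a], both zero
    outside the cell of [a]; [slot] recovers the address from a position in the cell. *)
Variables (S1 S2 : nat -> nat -> bool) (slot : nat -> nat).
Hypothesis G1 : forall z : Z, (forall l, f (z l) != None) ->
  G (set_bits z (S1 (address z))) = Some false.
Hypothesis G2 : forall z : Z, (forall l, f (z l) != None) ->
  G (set_bits z (S2 (address z))) = Some true.
Hypothesis slotP : forall a (i : 'I_N), (n * k <= i)%N -> S1 a i || S2 a i -> slot i = a.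

Variables (Gam : bits n -> bits n -> R) (lam : R) (del : bits n -> R).
Hypothesis adv : adversary f Gam lam del.

Lemma set_bits_bit (i : 'I_N) :
  (exists (l : 'I_k) (j : 'I_n), forall z, set_bits z (fun=> false) i = z l j) \/
  (exists c, forall z, set_bits z (fun=> false) i = c).
Proof.
case e: (decode n k i) => [[l j]|]; [left; exists l, j|right; exists false].
  by move=> z; rewrite ffunE e.
by move=> z; rewrite ffunE e.
Qed.

Lemma del_prod_sq : \sum_(z : Z) del_prod del z ^+ 2 = 1.
Proof.
under eq_bigr do rewrite /del_prod -prodrXl.
rewrite -(bigA_distr_bigA (fun _ x => del x ^+ 2)).
by rewrite big1 // => l _; case: adv => _ _ _ _ [].
Qed.

Lemma del_prod_support (z : Z) : del_prod del z != 0 -> forall l, f (z l) != None.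
Proof.
move=> nz l; apply: contra nz => /eqP hz.
by rewrite /del_prod (bigD1 l) //= (del_support adv hz) mul0r.
Qed.

Variables (K D : finType) (T : nat) (U : nat -> op R (Sp N (K * D)%type)).
Variable init : Sp N (K * D)%type.
Hypothesis unitU : forall t, (t <= T)%N -> unitary (U t).
Hypothesis sepU : forall x y bx byy, G x = Some bx -> G y = Some byy -> bx != byy ->
  trace_dist_ge (reduced (run U init x T)) (reduced (run U init y T)) (1 / 6).

Let zero z := set_bits z (fun=> false).
(** The queried position itself, read as an address, is the guess of all inner values. *)
Let guess (s : Sp N (K * D)%type) : {ffun 'I_k -> bool} :=
  [ffun l : 'I_k => odd (slot s.1.1 %/ 2 ^ l)].
Let hit (z : Z) t : C := \sum_(s | [forall l, f (z l) == Some (guess s l)]) `|run U init (zero z) t s| ^+ 2.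

(** Both inputs are compared with the zero array, from which they differ only in the addressed cell;
    the two hybrid bounds combine to 2 (4 T + 4 T) = 16 T times the query weight. *)
Lemma hit_ge (z : Z) : (forall l, f (z l) != None) ->
  1 / 36 <= 16 * T%:R * \sum_(t < T) hit z t.
Proof.
move=> hz; pose a := address z.
pose A (i : 'I_N) := (decode n k i == None) && (S1 a i || S2 a i).
have diff S i : (S =1 S1 a) \/ (S =1 S2 a) -> ~~ A i -> set_bits z S i = zero z i.
  move=> hS; rewrite /A !ffunE; case: (decode n k i) => //= /norP [/negbTE h1 /negbTE h2].
  by case: hS => ->.
have mass_hit t : mass A (run U init (zero z) t) <= hit z t.
  rewrite /mass /hit big_mkcond [leRHS]big_mkcond; apply: ler_sum => s _.
  case: ifP => [/andP [/eqP di ai]|_]; last by case: ifP => _ //; rewrite exprn_ge0.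
  case: ifP => [_ //|/negbT/forallPn [l /eqP []]].
  have ge : (n * k <= s.1.1)%N.
    rewrite leqNgt; apply/negP => lt; move: di.
    have n0 : (0 < n)%N by move: lt; case: (n).
    have hl : (s.1.1 %/ n < k)%N by rewrite ltn_divLR // mulnC.
    have hj : (s.1.1 %% n < n)%N by rewrite ltn_pmod.
    by rewrite /decode (insubT (fun i => (i < k)%N) hl) (insubT (fun i => (i < n)%N) hj).
  rewrite /guess ffunE (slotP ge ai) /a /address binary_digit.
  by have := hz l; case: (f (z l)) => [[]|].
have n1 x : sqn (run U init x T) = 1 by exact: (sqn_run _ _ unitU).
have := trace_dist_le (n1 _) (n1 _) (sepU (G1 hz) (G2 hz) isT).
move/le_trans; apply.
set x1 := set_bits z (S1 _); set x2 := set_bits z (S2 _).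
pose e x s := run U init x T s - run U init (zero z) T s.
have -> : sqn (fun s => run U init x1 T s - run U init x2 T s) = sqn (fun s => e x1 s - e x2 s).
  by congr sqn; apply/funext => s; rewrite /e opprB addrA subrK.
apply: le_trans (sqnB2 _ _) _.
have E (x : bits N) : (forall i, ~~ A i -> x i = zero z i) ->
    sqn (e x) <= T%:R * (4 * \sum_(t < T) hit z t).
  move=> hx; apply: le_trans (run_diff init unitU hx (leqnn T)) _.
  apply: ler_wpM2l => //; apply: ler_wpM2l => //.
  by apply: ler_sum => t _; exact: mass_hit.
have E1 : sqn (e x1) <= T%:R * (4 * \sum_(t < T) hit z t).
  by apply: E => i; apply: diff; left.
have E2 : sqn (e x2) <= T%:R * (4 * \sum_(t < T) hit z t).
  by apply: E => i; apply: diff; right.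
apply: le_trans (_ : 2 * (T%:R * (4 * \sum_(t < T) hit z t) + T%:R * (4 * \sum_(t < T) hit z t)) <= _).
  by apply: ler_wpM2l => //; exact: lerD.
by rewrite le_eqVlt; apply/orP; left; apply/eqP; ring.
Qed.

(** Averages [hit_ge] over the distribution [del_prod] squared and bounds each of the T summands by
    the direct product; 576 = 36 * 16. *)
Lemma query_weight_bound :
  1 <= 576 * T%:R ^+ 2 * ((5 / 9) ^+ k * (1 + 8 / lam) ^+ T) :> R.
Proof.
have lam0 : 0 < lam by case: adv => -[].
pose B : R := (5 / 9) ^+ k * (1 + 8 / lam) ^+ T.
have hitB (t : 'I_T) : \sum_(z : Z) (del_prod del z ^+ 2)%:C%C * hit z t <= B%:C%C.
  apply: le_trans (direct_product adv set_bits_bit init unitU guess (ltnW (ltn_ord t))) _.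
  rewrite lecR ler_pM2l ?exprn_gt0 ?divr_gt0 //.
  apply: ler_weXn2l; last exact: ltnW (ltn_ord t).
  by rewrite lerDl divr_ge0 // ltW.
have : (1 / 36 : C) <= 16 * T%:R * (T%:R * B%:C%C).
  apply: le_trans (_ : \sum_(z : Z) (del_prod del z ^+ 2)%:C%C * (16 * T%:R * \sum_(t < T) hit z t) <= _).
    have -> : (1 / 36 : C) = \sum_(z : Z) (del_prod del z ^+ 2)%:C%C * (1 / 36).
      rewrite -mulr_suml -rmorph_sum.
      have -> : \sum_(z : Z) del_prod del z ^+ 2 = 1 by exact: del_prod_sq.
      by rewrite rmorph1 [RHS]mul1r.
    apply: ler_sum => z _; have [->|nz] := eqVneq (del_prod del z) 0.
      by rewrite expr0n rmorph0 !mul0r.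
    apply: ler_wpM2l; first by rewrite lecR sqr_ge0.
    by apply: hit_ge; exact: del_prod_support.
  have -> : \sum_(z : Z) (del_prod del z ^+ 2)%:C%C * (16 * T%:R * \sum_(t < T) hit z t) =
      16 * T%:R * \sum_(t < T) \sum_(z : Z) (del_prod del z ^+ 2)%:C%C * hit z t.
    rewrite exchange_big mulr_sumr; apply: eq_bigr => z _ /=.
    by rewrite mulrCA -mulr_sumr.
  apply: ler_wpM2l; first by rewrite mulr_ge0.
  apply: le_trans (_ : \sum_(t < T) B%:C%C <= _); first exact: ler_sum.
  by rewrite sumr_const card_ord mulr_natl.
have -> : (1 / 36 : C) = (1 / 36)%:C%C by rewrite rmorphM fmorphV rmorph1 rmorph_nat.
have -> : (16 * T%:R * (T%:R * B%:C%C) : C) = (16 * T%:R * (T%:R * B))%:C%C.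
  by rewrite !rmorphM !rmorph_nat.
rewrite lecR /B; nra.
Qed.

End QueryWeight.

(** * Constants *)

(** (1 + x)^T <= e^(k/4), and e^(-1/4) >= 3/4. *)
Lemma growth_le (R : realType) (x : R) T k : 0 <= x -> T%:R * x <= k%:R / 4 ->
  (1 + x) ^+ T <= (4 / 3) ^+ k.
Proof.
move=> x0 h.
apply: (@le_trans _ _ (expR x ^+ T)).
  apply: lerXn2r; last exact: expR_ge1Dx.
    by rewrite nnegrE addr_ge0.
  by rewrite nnegrE expR_ge0.
rewrite -expRM_natl; apply: (@le_trans _ _ (expR (k%:R * (1 / 4)))).
  by rewrite ler_expR mulrA mulr1.
rewrite expRM_natl; apply: lerXn2r.
- by rewrite nnegrE expR_ge0.
- by rewrite nnegrE divr_ge0.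
have := expR_ge1Dx (- (1 / 4) : R); rewrite expRN => h1.
have e0 := expR_gt0 (1 / 4 : R).
have : (1 + - (1 / 4)) * expR (1 / 4) <= 1 :> R by rewrite -ler_pdivlMr // [leRHS]div1r.
lra.
Qed.

Lemma growth_mul_le1 (R : realType) (x : R) T : 0 <= x -> (1 + x) ^+ T * (1 - T%:R * x) <= 1.
Proof.
move=> x0; elim: T => [|T IH]; first by rewrite expr0 mul0r subr0 mulr1.
apply: le_trans IH; rewrite exprSr -mulrA; apply: ler_wpM2l.
  by rewrite exprn_ge0 // addr_ge0.
rewrite -natr1; have := sqr_ge0 x; have : 0 <= (T%:R : R) by rewrite ler0n.
nra.
Qed.

Section Bounds.
Variables (R : realType) (n : nat) (f : pfun n).

Lemma computes_dim q : computes R f q -> (0 < n)%N.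
Proof. by move=> [W [U [init _]]]; case: init => -[i _] _; exact: leq_ltn_trans (ltn_ord i). Qed.

(** The direct product with k = 1: if 8 q / lam < 1/6 then (1 + 8 / lam)^q < 6/5, and success stays
    below (5/9)(6/5) = 2/3. *)
Lemma adversary_le_computes Gam lam del q : @adversary R n f Gam lam del ->
  computes R f q -> lam <= 48 * q%:R.
Proof.
move=> adv [W [U [init [out [hU hout]]]]]; rewrite leNgt; apply/negP => hq.
have lam0 : 0 < lam by case: adv => -[].
pose inp (z : {ffun 'I_1 -> bits n}) := z ord0.
have inp_bit (i : 'I_n) : (exists (l : 'I_1) (j : 'I_n), forall z, inp z i = z l j) \/
    (exists c, forall z, inp z i = c) by left; exists ord0, i.
pose guess (s : Sp n W) : {ffun 'I_1 -> bool} := [ffun=> out s].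
have := direct_product adv inp_bit init hU guess (leqnn q).
apply/negP; rewrite -real_ltNge; last 2 first.
- by apply: ger0_real; rewrite lecR mulr_ge0 // exprn_ge0 ?divr_ge0 // addr_ge0 // divr_ge0 // ltW.
- apply: ger0_real; apply: sumr_ge0 => z _; rewrite mulr_ge0 ?lecR ?sqr_ge0 //.
  by rewrite sumr_ge0 // => s _; rewrite exprn_ge0.
apply: (@lt_le_trans _ _ (\sum_(z : {ffun 'I_1 -> bits n}) (del_prod del z ^+ 2)%:C%C * (2 / 3))).
  rewrite -mulr_suml -rmorph_sum (del_prod_sq _ adv) /= mul1r.
  have -> : (2 / 3 : R[i]) = (2 / 3)%:C%C by rewrite rmorphM fmorphV !rmorph_nat.
  rewrite ltcR expr1.
  have x0 : 0 <= 8 / lam by rewrite divr_ge0 // ltW.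
  have hx : q%:R * (8 / lam) < 1 / 6 by rewrite mulrA ltr_pdivrMr //; lra.
  have := growth_mul_le1 q x0.
  have : 0 < (1 + 8 / lam) ^+ q by rewrite exprn_gt0 // ltr_pwDl.
  set p := _ ^+ q; set y := q%:R * _ in hx *; nra.
apply: ler_sum => z _; have [->|nz] := eqVneq (del_prod del z) 0.
  by rewrite expr0n rmorph0 !mul0r.
apply: ler_wpM2l; first by rewrite lecR sqr_ge0.
have := del_prod_support adv nz ord0; case e: (f (z ord0)) => [b|] // _.
apply: le_trans (hout _ _ e) _; rewrite le_eqVlt; apply/orP; left; apply/eqP.
apply: eq_bigl => s; apply/eqP/forallP => [hb l|/(_ ord0)].
  by rewrite (ord1 l) e ffunE hb.
by rewrite e ffunE => /eqP [->].
Qed.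

Lemma feasible_ge1 (d : R) x y : f x = Some true -> f y = Some false ->
  feasible f d -> 1 <= d.
Proof.
move=> fx fy [M [a [cost dual]]].
rewrite -(dual x y fx fy).
apply: (@le_trans _ _ ((\sum_i \sum_m a x i m ^+ 2 + \sum_i \sum_m a y i m ^+ 2) / 2)).
  rewrite -big_split mulr_suml; apply: ler_sum => i _ /=.
  rewrite -big_split mulr_suml; apply: ler_sum => m _ /=.
  have := sqr_ge0 (a x i m - a y i m); have := sqr_ge0 (a x i m); have := sqr_ge0 (a y i m).
  by case: (_ != _) => /=; rewrite ?mul1r ?mul0r; nra.
have := cost x true fx; have := cost y false fy; lra.
Qed.

Lemma constant_computes b : (0 < n)%N -> (forall x, f x <> Some (~~ b)) -> computes R f 0.
Proof.
move=> n0 hb.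
have u1 : unitary (diag_op (fun _ : Sp n unit => 1 : R[i])).
  by apply: unitary_diag => h; rewrite rmorph1 mul1r.
exists unit, (fun=> diag_op (fun=> 1)), ((Ordinal n0, false), tt), (fun=> b).
split=> // x b' fx.
have -> : b' = b by case: b b' hb fx => -[] // hb fx; case: (hb x).
rewrite (eq_bigl xpredT) => [|s]; last by rewrite eqxx.
rewrite -[leRHS]/(sqn (mapply _ _)) unitary_sqn // sqn_basis.
by rewrite ler_pdivrMr ?ltr0n // mul1r ler_nat.
Qed.

Lemma adversary_ge q : Q_is R f q -> (0 < q)%N ->
  exists Gam lam del, @adversary R n f Gam lam del /\ q%:R <= 12 * lam.
Proof.
move=> [hq qmin] q0; have n0 := computes_dim hq.
(* For q <= 3 the rounded cost (q - 1) / 3 can be 0, where no algorithm is at hand; non-constancy of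
   [f] gives cost at least 1 instead. *)
have [q3|q4] := leqP q 3.
  have hex b : exists x, f x = Some b.
    apply: contrapT => h; have : computes R f 0.
      apply: (@constant_computes (~~ b)) => // x; rewrite negbK => fx.
      by apply: h; exists x.
    by move/qmin; rewrite leqNgt q0.
  have [x fx] := hex true; have [y fy] := hex false.
  have [||Gam [lam [del [adv hlam]]]] := @infeasible_adversary R n f (1 / 2).
  - by rewrite divr_ge0.
  - by move/(feasible_ge1 fx fy); lra.
  exists Gam, lam, del; split=> //.
  have : (q%:R <= 3%:R :> R) by rewrite ler_nat.
  lra.
(* The largest d with 3 d < q: a dual solution of this cost would beat the minimal [q]. *)
pose d := ((q - 1) %/ 3)%N.
have d0 : (0 < d)%N by rewrite divn_gt0 //; lia.
have [||Gam [lam [del [adv hlam]]]] := @infeasible_adversary R n f d%:R.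
- by rewrite ler0n.
- move/(feasible_computes n0 d0)/qmin.
  by have := leq_trunc_div (q - 1) 3; rewrite -/d; lia.
exists Gam, lam, del; split=> //.
have : (q <= 12 * d)%N by rewrite /d; lia.
rewrite -(ler_nat R) natrM; lra.
Qed.

Lemma feasible_of_computes q : computes R f q -> feasible f (48 * q%:R : R).
Proof.
move=> hq; apply: contrapT => /infeasible_adversary [|Gam [lam [del [adv hlam]]]].
  by rewrite mulr_ge0.
by have := adversary_le_computes adv hq; rewrite leNgt hlam.
Qed.

End Bounds.

(** 384 = 4 * 8 * 12: if 384 T < k q then 8 T / lam <= k / 4, as [growth_le] requires. *)
Lemma query_count_ge (R : realType) (lam : R) q k T : 0 < lam -> q%:R <= 12 * lam ->
  (q ^ 16 <= 2 ^ k)%N ->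
  1 <= 576 * T%:R ^+ 2 * ((5 / 9) ^+ k * (1 + 8 / lam) ^+ T) ->
  (k * q <= 384 * T)%N.
Proof.
move=> lam0 hq hk h1; rewrite leqNgt; apply/negP => hT.
have hTR : 384 * T%:R < k%:R * q%:R :> R by rewrite -!natrM ltr_nat.
have T0 : 0 <= (T%:R : R) by rewrite ler0n.
have k0 : 0 <= (k%:R : R) by rewrite ler0n.
have q0 : 0 <= (q%:R : R) by rewrite ler0n.
have growth : (1 + 8 / lam) ^+ T <= (4 / 3) ^+ k.
  apply: growth_le; first by rewrite divr_ge0 // ltW.
  rewrite mulrA ler_pdivrMr //; nra.
have h2 : 1 <= 576 * T%:R ^+ 2 * (20 / 27) ^+ k :> R.
  apply: le_trans h1 _; apply: ler_wpM2l; first by rewrite mulr_ge0 // exprn_ge0.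
  have -> : (20 / 27 : R) = (5 / 9) * (4 / 3) by field.
  by rewrite [leRHS]exprMn ler_pM2l // exprn_gt0 // divr_gt0.
have h3 : (27 / 20) ^+ k < (k%:R * q%:R / 16) ^+ 2 :> R.
  apply: (@le_lt_trans _ _ (576 * T%:R ^+ 2)); last by nra.
  rewrite -[leRHS]mulr1.
  have e : (20 / 27) ^+ k * (27 / 20) ^+ k = 1 :> R.
    by rewrite -exprMn (_ : 20 / 27 * (27 / 20) = 1) ?expr1n //; field.
  rewrite -[X in _ <= _ * X]e mulrA -[leLHS]mul1r; apply: ler_wpM2r => //.
  by rewrite exprn_ge0 // divr_ge0.
(* The eighth power produces q^16 <= 2^k; the contradiction is then (11/10)^16 * 2 <= (27/20)^8. *)
have h4 : ((27 / 20) ^+ k) ^+ 8 < ((k%:R * q%:R / 16) ^+ 2) ^+ 8 :> R.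
  by rewrite ltrXn2r // ?nnegrE ?exprn_ge0 ?divr_ge0 ?mulr_ge0.
have h5 : k%:R / 16 <= (11 / 10) ^+ k :> R.
  apply: (@le_trans _ _ (1 + k%:R * (1 / 10))); first by lra.
  elim: (k) => [|m IH]; first by rewrite expr0 mul0r addr0.
  rewrite exprS -natr1.
  have : 0 <= (m%:R : R) by rewrite ler0n.
  nra.
have h6 : (q%:R : R) ^+ 16 <= 2 ^+ k by rewrite -!natrX ler_nat.
move: h4; rewrite -exprM -exprM -[(2 * 8)%N]/16%N.
rewrite (_ : k%:R * q%:R / 16 = k%:R / 16 * q%:R); last by ring.
rewrite [(k%:R / 16 * q%:R) ^+ _]exprMn; apply/negP; rewrite -leNgt.
apply: (@le_trans _ _ (((11 / 10) ^+ k) ^+ 16 * 2 ^+ k)).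
  apply: ler_pM => //; try by rewrite exprn_ge0 ?divr_ge0.
  by apply: lerXn2r => //; rewrite nnegrE ?exprn_ge0 ?divr_ge0.
rewrite -exprM (mulnC k) exprM -exprMn [leRHS](_ : _ = ((27 / 20) ^+ 8) ^+ k); last first.
  by rewrite -exprM mulnC.
by apply: lerXn2r; rewrite ?nnegrE; lra.
Qed.

Section Compositions.
Variables (R : realType) (n k : nat) (f : pfun n).
Variables (Gam : bits n -> bits n -> R) (lam : R) (del : bits n -> R).
Hypothesis adv : adversary f Gam lam del.

Let address_lt (z : {ffun 'I_k -> bits n}) : (address f z < 2 ^ k)%N.
Proof. exact: binary_lt. Qed.

Lemma IndComp_query_weight T : separates R (@IndComp n k f) T ->
  1 <= 576 * T%:R ^+ 2 * ((5 / 9) ^+ k * (1 + 8 / lam) ^+ T).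
Proof.
move=> [K [D [U [init [hU hsep]]]]].
apply: (@query_weight_bound R n k _ f (@IndComp n k f)
  (fun _ _ => false) (fun a i => i == n * k + a)%N (fun i => i - n * k)%N
  _ _ _ Gam lam del adv K D T U init hU hsep).
- move=> z hz; rewrite /IndComp inner_index_set_bits ?leq_addr //= nbit_set_bits ?leq_addr //.
  by rewrite ltn_add2l.
- move=> z hz; rewrite /IndComp inner_index_set_bits ?leq_addr //= nbit_set_bits ?leq_addr //.
    by rewrite eqxx.
  by rewrite ltn_add2l.
- by move=> a i _ /= /eqP ->; rewrite addKn.
Qed.

Lemma UIndComp_query_weight T : separates R (@UIndComp n k f) T ->
  1 <= 576 * T%:R ^+ 2 * ((5 / 9) ^+ k * (1 + 8 / lam) ^+ T).
Proof.
move=> [K [D [U [init [hU hsep]]]]].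
have val (z : {ffun 'I_k -> bits n}) (S : nat -> bool) b : (forall l, f (z l) != None) ->
    (forall j, S (n * k + 2 * j + 1)%N = (j == address f z)) ->
    S (n * k + 2 * address f z)%N = b ->
    @UIndComp n k f (set_bits (n * k + 2 * 2 ^ k) z S) = Some b.
  move=> hz hS <-; rewrite /UIndComp inner_index_set_bits ?leq_addr //.
  have := address_lt z; move: (address f z) hS => a hS ha.
  case: ifP => [_|/negbT/forallPn [j]]; last first.
    have := ltn_ord j; set p := (2 ^ k)%N in ha * => hj.
    by rewrite nbit_set_bits ?hS ?eqxx ?leq_addr //; lia.
  by rewrite nbit_set_bits ?leq_addr //; lia.
apply: (@query_weight_bound R n k _ f (@UIndComp n k f)
  (fun a i => i == n * k + 2 * a + 1)%N
  (fun a i => (i == n * k + 2 * a + 1) || (i == n * k + 2 * a))%N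
  (fun i => (i - n * k) %/ 2)%N
  _ _ _ Gam lam del adv K D T U init hU hsep).
- by move=> z hz; apply: val => // [j|]; lia.
- by move=> z hz; apply: val => // [j|]; lia.
- by move=> a i hi /=; lia.
Qed.

End Compositions.

(** Everything follows from qs <= qq <= 3 (48 k q + 1) <= 147 k q and k q <= 384 qs; the product 147
    * 384 is below 200 * 400. *)
Lemma theta_bounds (R : realType) n (f : pfun n) k q N (G : pfun N) qs qq :
  Q_is R f q -> (0 < q)%N -> (0 < k)%N -> (16 * up_log 2 q <= k)%N -> (0 < N)%N ->
  (forall d : R, feasible f d -> feasible G (k%:R * d + 1)) ->
  (forall Gam lam del T, @adversary R n f Gam lam del -> separates R G T ->
     1 <= 576 * T%:R ^+ 2 * ((5 / 9) ^+ k * (1 + 8 / lam) ^+ T)) ->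
  QS_is R G qs -> Q_is R G qq ->
  [/\ (qs <= 200 * 400 * qq)%N, (qq <= 200 * 400 * qs)%N,
      (qq <= 200 * 400 * (k * q))%N & (k * q <= 200 * 400 * qq)%N].
Proof.
move=> hQ q0 k0 hk N0 hfeas hweight [hqs qs_min] [hqq qq_min].
have qs_qq : (qs <= qq)%N by exact/qs_min/computes_separates.
have qq_le : (qq <= 3 * (48 * (k * q) + 1))%N.
  apply/qq_min/feasible_computes => //; first by rewrite addn1.
  rewrite natrD natrM natrM mulrCA; apply: hfeas; apply: feasible_of_computes.
  by case: hQ.
have kq0 : (0 < k * q)%N by rewrite muln_gt0 k0.
have kq_le : (k * q <= 384 * qs)%N.
  have [Gam [lam [del [adv hq]]]] := adversary_ge hQ q0.
  apply: (query_count_ge _ hq _ (hweight _ _ _ _ adv hqs)); first by case: adv => -[].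
  apply: (@leq_trans ((2 ^ up_log 2 q) ^ 16)); first by rewrite leq_exp2r // up_logP.
  by rewrite -expnM leq_exp2l // mulnC.
move: (k * q)%N kq0 qq_le kq_le => m m0 h1 h2.
by split; lia.
Qed.

Theorem theorem17 :
  exists c A : nat,
  forall (R : realType) (n : nat) (f : pfun n) (k q : nat),
    Q_is R f q -> (0 < q)%N -> (0 < k)%N ->
    (c * up_log 2 q <= k)%N ->
    (forall qs qq, QS_is R (@IndComp n k f) qs -> Q_is R (@IndComp n k f) qq ->
       [/\ (qs <= A * qq)%N, (qq <= A * qs)%N,
           (qq <= A * (k * q))%N & (k * q <= A * qq)%N]) /\
    (forall qs qq, QS_is R (@UIndComp n k f) qs -> Q_is R (@UIndComp n k f) qq ->
       [/\ (qs <= A * qq)%N, (qq <= A * qs)%N,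
           (qq <= A * (k * q))%N & (k * q <= A * qq)%N]).
Proof.
exists 16%N, (200 * 400)%N => R n f k q hQ q0 k0 hk.
have n0 : (0 < n)%N by case: hQ => /computes_dim.
have N0 m : (0 < n * k + m)%N by rewrite addn_gt0 muln_gt0 n0 k0.
split=> qs qq hqs hqq.
  apply: (theta_bounds hQ q0 k0 hk (N0 _) _ _ hqs hqq) => [d|Gam lam del T].
    exact: IndComp_feasible.
  by move=> adv; exact: (IndComp_query_weight adv).
apply: (theta_bounds hQ q0 k0 hk (N0 _) _ _ hqs hqq) => [d|Gam lam del T].
  exact: UIndComp_feasible.
by move=> adv; exact: (UIndComp_query_weight adv).
Qed.
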